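(* Let $d\ge2$. There are positive constants $c_d,c_d'$ depending only on $d$ with the following property. Let $w$ be a weight on $\mathbb{S}^{d-1}$ with $w(\mathbb{S}^{d-1})=1$ such that $w(B)>0$ for every nonempty spherical cap $B\subset\mathbb{S}^{d-1}$. Let $r\in(0,\pi]$ and let $N$ be a positive integer satisfying $\min_{x\in\mathbb{S}^{d-1}}w(B(x,r))\ge\frac1N$. Then there exist a convex partition $\{R_1,\dots,R_M\}$ of $\mathbb{S}^{d-1}$ and points $x_1,\dots,x_M\in\mathbb{S}^{d-1}$ such that, for every $1\le j\le M$, $$B(x_j,c_d' r)\subset R_j\subset B(x_j,c_d r)\quad\text{and}\quad N\,w(R_j)\in\mathbb{N}.$$
   Context: $\mathbb{S}^{d-1}=\{x\in\mathbb{R}^d:\|x\|=1\}$ carries the surface Lebesgue measure $d\sigma_d$ and geodesic distance $\mathtt{d}(x,y)=\arccos(x\cdot y)$; $B(x,r)=\{y\in\mathbb{S}^{d-1}:\mathtt{d}(x,y)\le r\}$ is the spherical cap with center $x$ and radius $r>0$. A weight is a nonnegative integrable function $w$ on $\mathbb{S}^{d-1}$, and $w(E)=\int_E w\,d\sigma_d$. $\mathbb{N}$ is the set of positive integers. A subset $A\subset\mathbb{S}^{d-1}$ is geodesically convex if any two points $x,y\in A$ can be joined by a geodesic arc that lies entirely in $A$. A finite collection $\{R_1,\dots,R_M\}$ of closed geodesically convex subsets of $\mathbb{S}^{d-1}$ is a convex partition of $\mathbb{S}^{d-1}$ if $\mathbb{S}^{d-1}=\bigcup_{j=1}^M R_j$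 and the interiors of the sets $R_j$ are pairwise disjoint. *)

(* Defs.v *)
From HB Require Import structures.
From mathcomp Require Import all_boot all_order all_algebra.
From mathcomp Require Import all_classical all_reals all_analysis.
From mathcomp Require Import measurable_realfun.

Set Implicit Arguments.
Unset Strict Implicit.
Unset Printing Implicit Defensive.

Import Order.TTheory GRing.Theory Num.Theory.
Import numFieldNormedType.Exports.

Local Open Scope classical_set_scope.
Local Open Scope ring_scope.

(* As for tuples in the library, row vectors carry the sigma-algebra generated *)
(* by the coordinate projections; on 'rV[R]_n it is the Borel sigma-algebra.   *)
Definition measure_rV_display : measure_display. Proof. exact. Qed.

Section measurable_rV.
Context {R : realType} (n : nat).

Let coord (i : 'I_n) (v : 'rV[R]_n) : measurableTypeR R := v ord0 i.

Let rV_set0 : g_sigma_preimage coord set0.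
Proof. exact: sigma_algebra0. Qed.

Let rV_setC A : g_sigma_preimage coord A -> g_sigma_preimage coord (~` A).
Proof. exact: sigma_algebraC. Qed.

Let rV_bigcup (F : _^nat) : (forall i, g_sigma_preimage coord (F i)) ->
  g_sigma_preimage coord (\bigcup_i (F i)).
Proof. exact: sigma_algebra_bigcup. Qed.

HB.instance Definition _ := @isMeasurable.Build measure_rV_display
  'rV[R]_n (g_sigma_preimage coord) rV_set0 rV_setC rV_bigcup.

Lemma measurable_coord (i : 'I_n) :
  measurable_fun [set: 'rV[R]_n] (fun v => v ord0 i).
Proof.
move=> _ Y mY; rewrite setTI; apply: sub_sigma_algebra => /=.
rewrite -bigcup_seq/=; exists i => /=; first by rewrite mem_index_enum.
by exists Y => //; rewrite setTI.
Qed.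

Lemma measurable_fun_rV d (T : measurableType d) (f : T -> 'rV[R]_n) :
  (forall i, measurable_fun [set: T] (fun x => f x ord0 i)) ->
  measurable_fun [set: T] f.
Proof.
move=> mf.
suff H : g_sigma_preimage (fun i => coord i \o f) `<=` measurable.
  move=> _ A mA; rewrite setTI; apply: H.
  by rewrite g_sigma_preimage_comp; exists A => //; rewrite setTI.
apply: smallest_sub; first exact: sigma_algebra_measurable.
rewrite -bigcup_seq/=; apply: bigcup_sub => i _.
by move=> A [B mB <-]; exact: mf.
Qed.

End measurable_rV.

Section lebesgue_rV.
Context {R : realType}.

Definition cons_rV n (p : R * 'rV[R]_n) : 'rV[R]_n.+1 :=
  row_mx (p.1%:M : 'rV_1) p.2.

Definition uncons_rV n (v : 'rV[R]_n.+1) : R * 'rV[R]_n :=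
  (v ord0 ord0, \row_i v ord0 (lift ord0 i)).

Lemma cons_rVK n : cancel (@cons_rV n) (@uncons_rV n).
Proof.
move=> [a v]; rewrite /uncons_rV /cons_rV /=; congr pair.
  rewrite (_ : ord0 = lshift n (ord0 : 'I_1)); last exact/val_inj.
  by rewrite (row_mxEl (a%:M : 'rV_1) v) mxE mulr1n.
apply/rowP => i; rewrite mxE.
rewrite (_ : lift ord0 i = rshift 1 i); last exact/val_inj.
exact: (row_mxEr (a%:M : 'rV_1) v).
Qed.

Lemma measurable_cons_rV n :
  measurable_fun [set: measurableTypeR R * 'rV[R]_n] (@cons_rV n).
Proof.
apply: measurable_fun_rV => i.
case: (unliftP ord0 i) => [j ->|->].
  rewrite (_ : (fun _ => _) = (fun v : 'rV[R]_n => v ord0 j) \o snd).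
    by apply: measurableT_comp; [exact: measurable_coord|exact: measurable_snd].
  apply/funext => p /=; rewrite -[in RHS](cons_rVK p) /=.
  by rewrite mxE.
rewrite (_ : (fun _ => _) = fst); first exact: measurable_fst.
by apply/funext => p /=; rewrite -[in RHS](cons_rVK p).
Qed.

Lemma measurable_uncons_rV n : measurable_fun [set: 'rV[R]_n.+1]
  (@uncons_rV n : _ -> measurableTypeR R * 'rV[R]_n).
Proof.
apply/measurable_fun_pair; first exact: measurable_coord.
apply: measurable_fun_rV => i /=.
under eq_fun do rewrite mxE.
exact: measurable_coord.
Qed.

Section lebesgue_cons.
Local Open Scope ereal_scope.
Variables (n : nat) (mu : {sigma_finite_measure set 'rV[R]_n -> \bar R}).

Definition lebesgue_cons : set 'rV[R]_n.+1 -> \bar R :=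
  pushforward (@lebesgue_measure R \x mu) (@cons_rV n).

Let mcons := @measurable_cons_rV n.

Let lebesgue_cons0 : lebesgue_cons set0 = 0.
Proof. by rewrite /lebesgue_cons /pushforward preimage_set0 measure0. Qed.

Let lebesgue_cons_ge0 A : 0 <= lebesgue_cons A.
Proof. exact: measure_ge0. Qed.

Let lebesgue_cons_sigma_additive : semi_sigma_additive lebesgue_cons.
Proof. exact: measure_semi_sigma_additive. Qed.

HB.instance Definition _ := isMeasure.Build _ _ _ lebesgue_cons
  lebesgue_cons0 lebesgue_cons_ge0 lebesgue_cons_sigma_additive.

Let lebesgue_cons_sigma_finite : sigma_finite setT lebesgue_cons.
Proof.
have /sigma_finiteP[F [TF ndF Foo]] := sigma_finiteT (@lebesgue_measure R).
have /sigma_finiteP[G [TG ndG Goo]] := sigma_finiteT mu.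
exists (fun k => @uncons_rV n @^-1` (F k `*` G k)).
  rewrite -preimage_bigcup (_ : \bigcup_k _ = setT) ?preimage_setT//.
  apply/seteqP; split => // -[x y] _.
  have [i _ Fix] : (\bigcup_k F k) x by rewrite -TF.
  have [j _ Gjy] : (\bigcup_k G k) y by rewrite -TG.
  exists (maxn i j) => //; split => /=.
    by move: x Fix; exact/subsetPset/ndF/leq_maxl.
  by move: y Gjy; exact/subsetPset/ndG/leq_maxr.
move=> k; have [mF Fk] := Foo k; have [mG Gk] := Goo k; split.
  rewrite -[X in measurable X]setTI; apply: measurable_uncons_rV => //.
  exact: measurableX.
rewrite /lebesgue_cons /pushforward -comp_preimage.
rewrite (_ : _ \o _ = id); last by apply/funext => p /=; exact: cons_rVK.
by rewrite preimage_id product_measure1E// lte_mul_pinfty// ge0_fin_numE.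
Qed.

HB.instance Definition _ := Measure_isSigmaFinite.Build _ _ _ lebesgue_cons
  lebesgue_cons_sigma_finite.

End lebesgue_cons.

(* n-dimensional Lebesgue measure, as an iterated product. *)
Fixpoint lebesgue_rV n : {sigma_finite_measure set 'rV[R]_n -> \bar R} :=
  match n with
  | 0 => \d_ (0 : 'rV[R]_0)
  | n'.+1 => lebesgue_cons (lebesgue_rV n')
  end.

End lebesgue_rV.

Section sphere.
Context {R : realType} {d : nat}.
Implicit Types (x y v : 'rV[R]_d) (A : set 'rV[R]_d).

(* The library norm on 'rV[R]_d is the sup norm, hence the Euclidean one here. *)
Definition dotv x y : R := \sum_(i < d) x ord0 i * y ord0 i.

Definition enorm x : R := Num.sqrt (dotv x x).

Definition normalize x : 'rV[R]_d := (enorm x)^-1 *: x.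

Lemma measurable_enorm : measurable_fun [set: 'rV[R]_d] enorm.
Proof.
have -> : enorm = (fun a => a `^ 2^-1) \o (fun x => dotv x x).
  apply/funext => x /=; rewrite powR12_sqrt// /dotv.
  by apply: sumr_ge0 => i _; rewrite -expr2 sqr_ge0.
apply: measurableT_comp; first exact: measurable_powR.
apply: measurable_sum => i.
by apply: measurable_funM; exact: measurable_coord.
Qed.

Lemma measurable_normalize : measurable_fun [set: 'rV[R]_d] normalize.
Proof.
apply: measurable_fun_rV => i.
have -> : (fun x => normalize x ord0 i) =
    (fun x => (enorm x `^ (-1)) * x ord0 i).
  by apply/funext => x; rewrite mxE powR_inv1// sqrtr_ge0.
apply: measurable_funM; last exact: measurable_coord.
rewrite (_ : (fun _ => _) = (@powR R ^~ (-1)) \o enorm)//.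
apply: measurableT_comp; first exact: measurable_powR.
exact: measurable_enorm.
Qed.

Definition unit_ball : set 'rV[R]_d := [set x | enorm x <= 1].

Lemma measurable_unit_ball : measurable unit_ball.
Proof.
rewrite (_ : unit_ball = setT `&` enorm @^-1` `]-oo, 1]).
  exact: measurable_enorm.
by rewrite setTI; apply/seteqP; split => x /=; rewrite in_itv.
Qed.

Definition sphere : set 'rV[R]_d := [set x | enorm x = 1].

End sphere.

Section surface.
Local Open Scope ereal_scope.
Context {R : realType} (d : nat).

(* Lebesgue measure of the cone {x : 0 < |x| <= 1, x / |x| \in A} over A. *)
(* At the origin normalize is 0, which is not on the sphere.              *)
Definition cone_measure : set 'rV[R]_d -> \bar R :=
  pushforward (mrestr (lebesgue_rV d) measurable_unit_ball) normalize.

Let mnormalize := @measurable_normalize R d.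

Let cone_measure0 : cone_measure set0 = 0.
Proof. by rewrite /cone_measure /pushforward preimage_set0 measure0. Qed.

Let cone_measure_ge0 A : 0 <= cone_measure A. Proof. exact: measure_ge0. Qed.

Let cone_measure_sigma_additive : semi_sigma_additive cone_measure.
Proof. exact: measure_semi_sigma_additive. Qed.

HB.instance Definition _ := isMeasure.Build _ _ _ cone_measure
  cone_measure0 cone_measure_ge0 cone_measure_sigma_additive.

(* In polar coordinates, dx = t^(d-1) dt dsigma(x/|x|): the cone over A has *)
(* Lebesgue measure sigma(A) / d.                                           *)
Definition borel_surface_measure : set 'rV[R]_d -> \bar R :=
  mscale (NngNum (ler0n R d)) cone_measure.

HB.instance Definition _ := Measure.on borel_surface_measure.

End surface.

Section geometry.
Context {R : realType} {d : nat}.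
Implicit Types (x y v : 'rV[R]_d) (A E : set 'rV[R]_d) (w : 'rV[R]_d -> R).

(* The completion, so that weights are Lebesgue (not only Borel) measurable. *)
Definition surface_measure :=
  completed_measure_extension (mu := @borel_surface_measure R d).

(* Functions on the sphere are restrictions of functions on 'rV[R]_d; their *)
(* values off the sphere are irrelevant.                                    *)
Definition is_weight w : Prop :=
  (forall x, sphere x -> 0 <= w x) /\
  surface_measure.-integrable sphere (fun x => (w x)%:E).

Definition wmass w E : \bar R := (\int[surface_measure]_(x in E) (w x)%:E)%E.

Definition geodist x y : R := acos (dotv x y).

Definition cap x (r : R) : set 'rV[R]_d :=
  [set y | sphere y /\ geodist x y <= r].

(* Unit-speed great circle through x with unit tangent vector v at x. *)
Definition great_circle x v (t : R) : 'rV[R]_d := cos t *: x + sin t *: v.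

(* The joining arc has length geodist x y, i.e. it is length-minimizing; for *)
(* antipodal points any of the half great circles may be used.               *)
Definition geodesically_convex A : Prop :=
  forall x y, A x -> A y -> exists v : 'rV[R]_d,
    [/\ sphere v, dotv x v = 0, great_circle x v (geodist x y) = y &
        forall t, 0 <= t <= geodist x y -> A (great_circle x v t)].

(* Closedness and interior are relative to the sphere. *)
Definition convex_partition M (P : 'I_M -> set 'rV[R]_d) : Prop :=
  [/\ forall j, [/\ P j `<=` sphere, closed (P j : set (subspace sphere)) &
                    geodesically_convex (P j)],
      sphere = \bigcup_j P j &
      forall i j, i != j ->
        interior (P i : set (subspace sphere)) `&`
        interior (P j : set (subspace sphere)) = set0].

End geometry.

(* Main.v *)
From HB Require Import structures.
Require Import Defs.
From mathcomp Require Import all_boot all_order all_algebra.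
From mathcomp Require Import all_classical all_reals all_analysis.
From mathcomp Require Import measurable_realfun ring lra.

Set Implicit Arguments.
Unset Strict Implicit.
Unset Printing Implicit Defensive.

Import Order.TTheory GRing.Theory Num.Theory.
Import numFieldNormedType.Exports.

Local Open Scope classical_set_scope.
Local Open Scope ring_scope.

(* Project the sphere radially onto the facets of a box [-1/b_k^-, 1/b_k^+] in  *)
(* each coordinate.  Over the facet with normal +-e_i the ratios x_j / (+-x_i)  *)
(* are coordinates in which great subspheres are flat, so boxes in these ratios *)
(* are geodesically convex, and a box whose sides are all comparable to r is    *)
(* comparable to a cap of radius r; in particular its mass is at least 1/N.     *)
(* Hyperplanes are null, so masses vary continuously with the cuts.  If a facet *)
(* has integral mass (in units of 1/N), any box side longer than a certain      *)
(* multiple of r can be cut in two at a place where both halves have integral   *)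
(* mass, and iterating yields the cells.  To make all 2d facets integral, fix   *)
(* one facet l0, require every other facet to have at least the integer part of *)
(* its mass for b = 1, and take the least such b (feasible b are closed under   *)
(* minima, because lowering some b_k enlarges the other facets).  For the least *)
(* b these constraints are equalities, so the mass of l0 is integral as well.   *)
(* For r bounded below, the sphere itself is the only cell.                     *)

(** Two facts drive the subdivision. A box whose sides, in the ratio coordinates of a facet, are all
    at least [rho], where [rho] is 12 d r, contains a cap of radius r ([cap_sub_box]), so its mass
    is at least 1/N. The mass also varies continuously with each cut ([box_mass_continuous]).
    Sliding a cut by [rho] therefore raises N times the mass by at least 1 and meets an integer; if
    the box is integral, both halves are ([exists_integral_cut]). Cutting until no side exceeds 3
    [rho] ([exists_fine_cells]) leaves cells lying in caps of radius comparable to r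
    ([box_sub_cap]).

    Integral boxes to start from come from [exists_balanced_cells]. The componentwise infimum
    [bstar] of the feasible parameters is itself feasible, by [feasible_min] and continuity, and
    each constraint is tight there, since otherwise one parameter could be lowered. Lowering stays
    possible because the bound 1/2 is never attained: [feasible_gt_half] compares the mass that one
    facet would gain with what the others may lose.

    Cells overlap in null sets only; a common interior point would give a cap of positive mass in
    the overlap ([interior_disjoint]). *)

Section dot_product.
Context {R : realType} {d : nat}.
Implicit Types (x y : 'rV[R]_d).

(** * The Euclidean inner product *)

Lemma dotvC x y : dotv x y = dotv y x.
Proof. by apply: eq_bigr => i _; rewrite mulrC. Qed.

Lemma dotvDl x y z : dotv (x + y) z = dotv x z + dotv y z.
Proof.
rewrite /dotv -big_split; apply: eq_bigr => i _ /=.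
by rewrite mxE mulrDl.
Qed.

Lemma dotvZl a x y : dotv (a *: x) y = a * dotv x y.
Proof. by rewrite /dotv mulr_sumr; apply: eq_bigr => i _; rewrite mxE mulrA. Qed.

Lemma dotvNl x y : dotv (- x) y = - dotv x y.
Proof. by rewrite -scaleN1r dotvZl mulN1r. Qed.

Lemma dotvBl x y z : dotv (x - y) z = dotv x z - dotv y z.
Proof. by rewrite dotvDl dotvNl. Qed.

Lemma dotvDr x y z : dotv x (y + z) = dotv x y + dotv x z.
Proof. by rewrite !(dotvC x) dotvDl. Qed.

Lemma dotvZr a x y : dotv x (a *: y) = a * dotv x y.
Proof. by rewrite !(dotvC x) dotvZl. Qed.

Lemma dotvNr x y : dotv x (- y) = - dotv x y.
Proof. by rewrite !(dotvC x) dotvNl. Qed.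

Lemma dotvBr x y z : dotv x (y - z) = dotv x y - dotv x z.
Proof. by rewrite !(dotvC x) dotvBl. Qed.

Lemma dotv_ge0 x : 0 <= dotv x x.
Proof. by apply: sumr_ge0 => i _; rewrite -expr2 sqr_ge0. Qed.

Lemma sqr_coord_le_dotv x i : x ord0 i ^+ 2 <= dotv x x.
Proof.
rewrite /dotv (bigD1 i) //= -expr2 lerDl.
by apply: sumr_ge0 => j _; rewrite -expr2 sqr_ge0.
Qed.

Lemma dotv_eq0 x : dotv x x = 0 -> x = 0.
Proof.
move=> x0; apply/rowP => i; rewrite mxE; apply/eqP; rewrite -sqrf_eq0.
by apply/eqP/le_anti; rewrite sqr_ge0 andbT -x0 sqr_coord_le_dotv.
Qed.

Lemma sphereP x : sphere x <-> dotv x x = 1.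
Proof.
rewrite /sphere /= /enorm; split=> [h|->]; last exact: sqrtr1.
by rewrite -(sqr_sqrtr (dotv_ge0 x)) h expr1n.
Qed.

Lemma dotv_delta (i : 'I_d) x : dotv (delta_mx ord0 i) x = x ord0 i.
Proof.
rewrite /dotv (bigD1 i)//= mxE !eqxx mul1r big1 ?addr0// => j ji.
by rewrite mxE eqxx (negbTE ji) mul0r.
Qed.

Lemma measurable_dotv x : measurable_fun [set: 'rV[R]_d] (dotv x).
Proof.
apply: measurable_sum => i.
by apply: measurable_funM; [exact: measurable_cst|exact: measurable_coord].
Qed.

Lemma measurable_hyperplane x c : measurable [set y | dotv x y = c].
Proof.
rewrite (_ : [set y | _] = setT `&` dotv x @^-1` [set c]); last by rewrite setTI.
exact: measurable_dotv.
Qed.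

Lemma measurable_sphere : measurable (sphere : set 'rV[R]_d).
Proof.
rewrite (_ : sphere = setT `&` enorm @^-1` [set 1]); last by rewrite setTI.
exact: measurable_enorm.
Qed.

End dot_product.

(** * Hyperplanes are Lebesgue null *)

Section hyperplanes.
Local Open Scope ereal_scope.
Context {R : realType}.

Lemma dotv_cons n (a : 'rV[R]_n.+1) (p : R * 'rV[R]_n) :
  (dotv a (cons_rV p) = (uncons_rV a).1 * p.1 + dotv (uncons_rV a).2 p.2)%R.
Proof.
rewrite -[in RHS](cons_rVK p) /dotv big_ord_recl /=; congr (_ + _)%R.
by apply: eq_bigr => i _; rewrite !mxE.
Qed.

(** Fubini and induction on the dimension: the slice at [t] is a hyperplane one dimension lower
    whose constant depends on [t], hence the arbitrary [c]. If the tail of [a] vanishes, all slices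
    but one are empty. *)
Lemma lebesgue_hyperplane n (a : 'rV[R]_n) (c : R) : a != 0%R ->
  lebesgue_rV n [set x | dotv a x = c] = 0.
Proof.
elim: n a c => [|n IH] a c a0.
  by move: a0; rewrite (_ : a = 0%R) ?eqxx//; apply/rowP => -[].
rewrite /= /lebesgue_cons /pushforward /product_measure1.
set a' := (uncons_rV a).2.
have sec t : xsection (cons_rV (n:=n) @^-1` [set x | dotv a x = c]) t =
    [set x | dotv a' x = c - (uncons_rV a).1 * t]%R.
  apply/seteqP; split => v; rewrite /xsection /= inE /= dotv_cons /= -/a'.
    by move=> <-; rewrite addrAC subrr add0r.
  by move=> ->; rewrite addrC subrK.
have [a'0|a'0] := eqVneq a' 0%R; last first.
  rewrite (eq_integral (cst 0)); first exact: integral0.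
  by move=> t _ /=; rewrite sec IH.
have b0 : (uncons_rV a).1 != 0%R.
  apply: contra a0 => /eqP b0; apply/eqP/rowP => i; rewrite mxE.
  have [j ->|->] := unliftP ord0 i; last exact: b0.
  by have /rowP /(_ j) := a'0; rewrite !mxE.
pose t0 := (c / (uncons_rV a).1)%R.
apply: etrans.
  apply: (@ge0_negligible_integral _ (measurableTypeR R) R lebesgue_measure setT
    [set t0]) => //.
- apply: measurable_fun_xsection.
  rewrite -[X in measurable X]setTI.
  by apply: measurable_cons_rV => //; exact: measurable_hyperplane.
- exact: lebesgue_measure_set1.
rewrite (eq_integral (cst 0)); first exact: integral0.
move=> t; rewrite inE /= => -[_ /eqP tt0]; rewrite sec.
rewrite (_ : [set x | _] = set0) ?measure0//.
apply/seteqP; split => // v /=; rewrite a'0.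
rewrite (_ : dotv _ _ = 0%R); last by rewrite -(scale0r 0%R) dotvZl mul0r.
move=> /eqP; rewrite eq_sym subr_eq0 => /eqP cE; case/eqP: tt0.
by rewrite /t0 cE mulrAC mulfV ?mul1r.
Qed.

End hyperplanes.

(** * The weight as a Borel measure carried by the sphere *)

Section weighted_measure.
Local Open Scope ereal_scope.
Context {R : realType} {d : nat} (w : 'rV[R]_d -> R) (hw : is_weight w).

Let C := caratheodory_type (@borel_surface_measure R d)^*%mu.

Let borel_sub (A : set 'rV[R]_d) : measurable A -> measurable (A : set C).
Proof. exact: caratheodory_measurable_mu_ext. Qed.

(* The unused argument lets unification find the measure structure below, which *)
(* depends on [w] being a weight.                                               *)
Definition weighted_measure of is_weight w := fun A : set 'rV[R]_d =>
  wmass w (A `&` sphere).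

Let nu := weighted_measure hw.

Let mw (A : set 'rV[R]_d) : measurable A ->
  measurable_fun (A `&` sphere : set C)
    (fun x => (w x)%:E : \bar R).
Proof.
move=> mA; have [_ /integrableP[+ _]] := hw.
apply: measurable_funS.
by apply: borel_sub; exact: measurable_sphere.
exact: subIsetr.
Qed.

Let w_ge0 (A : set 'rV[R]_d) x : (A `&` sphere) x -> 0 <= (w x)%:E.
Proof. by move=> [_ sx]; rewrite lee_fin; case: hw => + _; exact. Qed.

Let nu0 : nu set0 = 0.
Proof. by rewrite /nu /weighted_measure set0I /wmass integral_set0. Qed.

Let nu_ge0 A : 0 <= nu A.
Proof. by apply: integral_ge0 => x; exact: w_ge0. Qed.

Let nu_sigma_additive : semi_sigma_additive nu.
Proof.
move=> F mF tF mUF.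
rewrite [X in _ --> X](_ : _ = \sum_(0 <= i <oo) nu (F i)).
  by apply: is_cvg_ereal_nneg_natsum => i _; exact: nu_ge0.
rewrite /nu /weighted_measure /wmass setI_bigcupl.
apply: (@ge0_integral_bigcup _ _ _ surface_measure
  (fun i => F i `&` sphere)) => [k|||].
- by apply: borel_sub; apply: measurableI => //; exact: measurable_sphere.
- by rewrite -setI_bigcupl; exact: mw.
- by move=> x; rewrite -setI_bigcupl; exact: w_ge0.
- exact: trivIset_setIr.
Qed.

HB.instance Definition _ := isMeasure.Build _ _ _ (weighted_measure hw)
  nu0 nu_ge0 nu_sigma_additive.

(** The cone over the section by a hyperplane through the origin lies in that hyperplane, so the
    section is null for the surface measure and for any density. *)
Lemma weighted_measure_hyperplane (a : 'rV[R]_d) : a != 0%R ->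
  weighted_measure hw [set x | dotv a x = 0%R] = 0.
Proof.
move=> a0.
have mA := measurable_hyperplane a 0%R.
have mAs := measurableI _ _ mA measurable_sphere.
apply: null_set_integral; [exact: borel_sub|exact: mw|].
apply: etrans.
  exact: (measurable_mu_extE (@borel_surface_measure R d) mAs).
suff h : cone_measure ([set x | dotv a x = 0%R] `&` sphere) = 0.
  by apply: etrans (mule0 _); congr (_ * _); exact: h.
rewrite /cone_measure /pushforward /mrestr.
apply/eqP; rewrite -measure_le0 -(lebesgue_hyperplane 0 a0).
apply: le_measure; rewrite ?inE //.
  apply: measurableI; last exact: measurable_unit_ball.
  by rewrite -[X in measurable X]setTI; exact: measurable_normalize.
(* Normalizing divides [dotv a x] by the norm, so zeros stay zeros unless the norm is 0; in that
   case [normalize x] is 0, which is not on the sphere. *)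
move=> x [[/= + sx] _]; rewrite /normalize dotvZr => /eqP.
rewrite mulf_eq0 => /orP[|/eqP//]; rewrite invr_eq0 => /eqP ex0.
move: sx => /sphereP; rewrite /normalize dotvZl dotvZr ex0 invr0 !mul0r.
by move=> /esym /eqP; rewrite oner_eq0.
Qed.

End weighted_measure.

(** * Finite measures: almost disjoint unions, continuity along monotone families *)

Section finite_measure.
Context {R : realType} {disp : measure_display} {T : measurableType disp}.
Context (mu : {measure set T -> \bar R}) (mu_fin : (mu setT < +oo)%E).
Implicit Types (A B Z : set T).

Definition rmass A : R := fine (mu A).

Lemma mu_fin_num A : measurable A -> mu A \is a fin_num.
Proof.
move=> mA; rewrite ge0_fin_numE//; apply: le_lt_trans mu_fin.
by apply: le_measure; rewrite ?inE.
Qed.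

Lemma rmassK A : measurable A -> ((rmass A)%:E = mu A)%E.
Proof. by move=> mA; rewrite /rmass fineK// mu_fin_num. Qed.

Lemma rmass_ge0 A : 0 <= rmass A.
Proof. exact: fine_ge0. Qed.

Lemma le_rmass A B : measurable A -> measurable B -> A `<=` B ->
  rmass A <= rmass B.
Proof.
move=> mA mB AB; rewrite -lee_fin !rmassK//.
by apply: le_measure; rewrite ?inE.
Qed.

Lemma null_sub A B : measurable A -> measurable B -> A `<=` B ->
  mu B = 0%E -> mu A = 0%E.
Proof.
move=> mA mB AB B0; apply/eqP; rewrite -measure_le0 -B0.
by apply: le_measure; rewrite ?inE.
Qed.

Lemma rmassU A B : measurable A -> measurable B -> mu (A `&` B) = 0%E ->
  rmass (A `|` B) = rmass A + rmass B.
Proof.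
move=> mA mB AB0; have mAB := measurableI _ _ mA mB.
have mBA : measurable (B `\` A) by exact: measurableD.
have -> : A `|` B = A `|` (B `\` A).
  apply/seteqP; split => x; first last.
    by move=> [Ax|[Bx _]]; [left|right].
  by move=> [Ax|Bx]; [left|have [Ax|Ax] := pselect (A x); [left|right]].
apply/EFin_inj; rewrite EFinD !rmassK//; last exact: measurableU.
rewrite measureU//; last by rewrite setDE setICA setICr setI0.
congr (_ + _)%E.
apply: etrans (esym (measureU0 mBA mAB AB0)) _; congr (mu _).
apply/seteqP; split => x; first by move=> [[]|[]].
by move=> Bx; have [Ax|Ax] := pselect (A x); [right|left].
Qed.

Lemma rmass_bigcup_seq (I : eqType) (F : I -> set T) (s : seq I) :
  (forall i, measurable (F i)) ->
  (forall i j, i != j -> mu (F i `&` F j) = 0%E) -> uniq s ->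
  measurable (\big[setU/set0]_(i <- s) F i) /\
  rmass (\big[setU/set0]_(i <- s) F i) = \sum_(i <- s) rmass (F i).
Proof.
move=> mF F0; elim: s => [|i s IH] /=.
  by rewrite !big_nil /rmass measure0.
move=> /andP[/negP si us]; have [mU U] := IH us.
rewrite !big_cons -U; split; first exact: measurableU.
apply: rmassU => //.
(* Passing to lists [t] inside [s] keeps [i] outside the list while the inner induction shortens
   it. *)
suff : forall t, {subset t <= s} ->
    mu (F i `&` \big[setU/set0]_(j <- t) F j) = 0%E.
  by move=> /(_ s (fun _ => id)).
elim=> [|j t IHt] ts; first by rewrite big_nil setI0 measure0.
rewrite big_cons setIUr measureU0; first last.
- by apply: IHt => k kt; apply: ts; rewrite inE kt orbT.
- by apply: measurableI => //; exact: bigsetU_measurable.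
- exact: measurableI.
apply: F0; apply/eqP => ij; apply: si; rewrite ij.
by apply: ts; rewrite inE eqxx.
Qed.

Lemma rmass_bigcup (I : finType) (F : I -> set T) :
  (forall i, measurable (F i)) ->
  (forall i j, i != j -> mu (F i `&` F j) = 0%E) ->
  rmass (\bigcup_i F i) = \sum_i rmass (F i).
Proof.
move=> mF F0; have [_ <-] := rmass_bigcup_seq mF F0 (index_enum_uniq I).
congr rmass; rewrite -bigcup_seq; apply/seteqP; split => x [i _ Fix].
  by exists i => //=; rewrite mem_index_enum.
by exists i.
Qed.

(** From the right this is continuity from above, by [rE]; from the left, continuity from below,
    where only the null set [Z] is lost. By monotonicity one good index on each side controls a
    whole neighbourhood. *)
Lemma rmass_continuous (E : R -> set T) Z t :
  (forall s, measurable (E s)) -> {homo E : s s' / s <= s' >-> s `<=` s'} ->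
  (forall x, (forall s, t < s -> E s x) -> E t x) ->
  measurable Z -> mu Z = 0%E ->
  (forall x, E t x -> ~ Z x -> exists2 s, s < t & E s x) ->
  {for t, continuous (fun s => rmass (E s))}.
Proof.
move=> mE hE rE mZ Z0 lE; apply/cvgrPdist_lt => e e0.
have le_mE : {homo (fun s => rmass (E s)) : s s' / s <= s'}.
  by move=> s s' ss'; apply: le_rmass => //; exact: hE.
have cvgm (F : nat -> set T) L : (forall n, measurable (F n)) -> measurable L ->
    (mu \o F) n @[n --> \oo] --> mu L -> exists n, `|rmass L - rmass (F n)| < e.
  move=> mF mL FL; have : (fun n => rmass (F n)) @ \oo --> rmass L.
    apply: fine_cvg; rewrite rmassK//; exact: FL.
  by move=> /cvgrPdist_lt /(_ _ e0)[n _ /(_ _ (leqnn n)) h]; exists n.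
have [n1 h1] : exists n, `|rmass (E t) - rmass (E (t + n.+1%:R^-1))| < e.
  apply: (cvgm (fun n => E (t + n.+1%:R^-1))) => //.
  have Ecap : E t = \bigcap_n E (t + n.+1%:R^-1).
    apply/seteqP; split => x Ex.
      by move=> n _; apply: (hE t) => //; rewrite lerDl.
    apply: rE => s; rewrite -subr_gt0 => st.
    have [n ns] := ltr_add_invr st.
    apply: (hE (t + n.+1%:R^-1)); last exact: Ex.
    by rewrite -lerBrDl; move: ns; rewrite add0r; exact: ltW.
  rewrite Ecap; apply: nonincreasing_cvg_mu.
  - by rewrite -ge0_fin_numE// mu_fin_num.
  - by move=> i; exact: mE.
  - by rewrite -Ecap.
  - move=> i j ij; apply/subsetPset; apply: hE; rewrite lerD2l lef_pV2 ?posrE//.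
    by rewrite ler_nat.
have [n2 h2] : exists n, `|rmass (E t) - rmass (E (t - n.+1%:R^-1))| < e.
  have mU : measurable (\bigcup_n E (t - n.+1%:R^-1)).
    by apply: bigcupT_measurable => i; exact: mE.
  have -> : rmass (E t) = rmass (\bigcup_n E (t - n.+1%:R^-1)).
    apply/le_anti/andP; split.
      have <- : rmass (\bigcup_n E (t - n.+1%:R^-1) `|` Z) =
                rmass (\bigcup_n E (t - n.+1%:R^-1)).
        by rewrite /rmass measureU0.
      apply: le_rmass => //; first exact: measurableU.
      move=> x Ex; have [Zx|Zx] := pselect (Z x); [by right|left].
      have [s + Esx] := lE x Ex Zx; rewrite -subr_gt0 => /ltr_add_invr[n ns].
      exists n => //; apply: (hE s) => //; rewrite lerBrDr -lerBrDl.
      by move: ns; rewrite add0r; exact: ltW.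
    apply: le_rmass => // x [n _]; apply: hE.
    by rewrite gerBl.
  apply: (cvgm (fun n => E (t - n.+1%:R^-1))) => //.
  apply: nondecreasing_cvg_mu => //.
  move=> i j ij; apply/subsetPset; apply: hE; rewrite lerD2l lerN2 lef_pV2 ?posrE//.
  by rewrite ler_nat.
near=> s.
have st1 : s <= t + n1.+1%:R^-1.
  near: s; exists n1.+1%:R^-1 => /=; first by rewrite invr_gt0.
  by move=> s /=; move: (_^-1) => a; rewrite ltr_norml => /andP[]; lra.
have st2 : t - n2.+1%:R^-1 <= s.
  near: s; exists n2.+1%:R^-1 => /=; first by rewrite invr_gt0.
  by move=> s /=; move: (_^-1) => a; rewrite ltr_norml => /andP[]; lra.
have := le_mE _ _ st1; have := le_mE _ _ st2.
have := h1; have := h2; rewrite !ltr_norml => /andP[_ a2] /andP[a1 _] b1 b2.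
by apply/andP; split; lra.
Unshelve. all: by end_near. Qed.

End finite_measure.

(** * Quadratic bounds for 1 - cos *)

Section trigonometric_bounds.
Context {R : realType}.
Implicit Types u : R.

Lemma sin_MVT u : 0 <= u -> exists2 c, 0 <= c <= u & sin u = cos c * u.
Proof.
move=> u0.
have cs : {within `[0, u], continuous (@sin R)}.
  by apply: continuous_subspaceT => x; exact: continuous_sin.
have [c] := MVT_segment u0 (fun x _ => is_derive_sin x) cs.
by rewrite sin0 !subr0 in_itv /= => cu ->; exists c.
Qed.

Lemma sin_le u : 0 <= u -> sin u <= u.
Proof. by move=> u0; have [c _ ->] := sin_MVT u0; rewrite ler_piMl// cos_le1. Qed.

Lemma one_sub_cos u : 1 - cos u = 2 * sin (u / 2) ^+ 2.
Proof.
have := cos_mulr2n (u / 2); have := cos2Dsin2 (u / 2).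
have -> : (u / 2) *+ 2 = u by rewrite -mulr_natr mulfVK// pnatr_eq0.
lra.
Qed.

Lemma one_sub_cos_le u : 0 <= u <= pi -> 1 - cos u <= u ^+ 2 / 2.
Proof.
move=> /andP[u0 upi]; rewrite one_sub_cos.
have u20 : 0 <= u / 2 by rewrite divr_ge0.
have := sin_le u20; have : 0 <= sin (u / 2).
  by apply: sin_ge0_pi; rewrite u20 /=; lra.
nra.
Qed.

(** As pi is at most 4, u/4 is at most 1 and cos is at least 1/2 on [0, u/4]. Hence sin (u/4) >= u/8
    by the mean value theorem, and doubling the angle gives sin (u/2) >= u/8. *)
Lemma one_sub_cos_ge u : 0 <= u <= pi -> u ^+ 2 / 32 <= 1 - cos u.
Proof.
move=> /andP[u0 upi]; rewrite one_sub_cos.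
have [/andP[_ pi4] _] := @pihalf_02_cos_pihalf R.
have u4 : 0 <= u / 4 by lra.
have cge c : 0 <= c <= u / 4 -> 1 / 2 <= cos c.
  move=> /andP[c0 cu]; have := @one_sub_cos_le c.
  have -> : 0 <= c <= pi by rewrite c0; lra.
  by move=> /(_ isT); nra.
have [c /cge c2 su] := sin_MVT u4.
have := cge (u / 4); rewrite u4 lexx => /(_ isT) cu4.
have sn : sin (u / 2) = 2 * (cos (u / 4) * sin (u / 4)).
  have := sin_mulr2n (u / 4).
  have -> : (u / 4) *+ 2 = u / 2 by rewrite -mulr_natr; lra.
  by move=> ->; rewrite -mulr_natl.
have s4 : u / 8 <= sin (u / 4) by rewrite su; nra.
have s2 : u / 8 <= sin (u / 2) by rewrite sn; nra.
nra.
Qed.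

End trigonometric_bounds.

(** * Caps, chords and geodesic convexity on the sphere *)

Section sphere_geometry.
Context {R : realType} {d : nat}.
Implicit Types (x y v : 'rV[R]_d) (A : set 'rV[R]_d).

Definition chord2 x y := dotv (x - y) (x - y).

Lemma chord2E x y : sphere x -> sphere y -> chord2 x y = 2 - 2 * dotv x y.
Proof.
move=> /sphereP x1 /sphereP y1.
by rewrite /chord2 !(dotvBl, dotvBr) x1 y1 (dotvC y x); lra.
Qed.

Lemma dotv_sphere_itv x y : sphere x -> sphere y -> -1 <= dotv x y <= 1.
Proof.
move=> sx sy; have := dotv_ge0 (x - y); have := dotv_ge0 (x + y).
rewrite -/(chord2 x y) chord2E// dotvDl !dotvDr (dotvC y x).
by move: sx sy => /sphereP -> /sphereP ->; lra.
Qed.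

Lemma geodist_itv x y : sphere x -> sphere y -> 0 <= geodist x y <= pi.
Proof.
by move=> sx sy; rewrite acos_ge0 ?acos_lepi// dotv_sphere_itv.
Qed.

Lemma cos_geodist x y : sphere x -> sphere y -> cos (geodist x y) = dotv x y.
Proof. by move=> sx sy; rewrite acosK// in_itv /= dotv_sphere_itv. Qed.

Lemma chord2_le_geodist x y : sphere x -> sphere y ->
  chord2 x y <= geodist x y ^+ 2.
Proof.
move=> sx sy; have := one_sub_cos_le (geodist_itv sx sy).
by rewrite cos_geodist// chord2E//; lra.
Qed.

Lemma geodist_le_chord2 x y : sphere x -> sphere y ->
  geodist x y ^+ 2 <= 16 * chord2 x y.
Proof.
move=> sx sy; have := one_sub_cos_ge (geodist_itv sx sy).
by rewrite cos_geodist// chord2E//; lra.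
Qed.

Lemma cap_coord_le x (r : R) y i : sphere x -> cap x r y ->
  `|x ord0 i - y ord0 i| <= r.
Proof.
move=> sx [sy xy]; have /andP[g0 _] := geodist_itv sx sy.
rewrite -(@ler_pXn2r _ 2) ?nnegrE ?normr_ge0//; last exact: le_trans xy.
rewrite real_normK ?num_real//.
apply: (@le_trans _ _ (chord2 x y)).
  by have := sqr_coord_le_dotv (x - y) i; rewrite !mxE.
apply: le_trans (chord2_le_geodist sx sy) _.
by rewrite ler_pXn2r ?nnegrE// (le_trans g0).
Qed.

Lemma measurable_cap x (r : R) : sphere x -> 0 <= r <= pi -> measurable (cap x r).
Proof.
move=> sx r0.
rewrite (_ : cap x r = sphere `&` dotv x @^-1` `[cos r, +oo[).
  apply: measurableI; first exact: measurable_sphere.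
  by rewrite -[X in measurable X]setTI; exact: measurable_dotv.
have capE y : sphere y -> (geodist x y <= r) = (cos r <= dotv x y).
  move=> sy; rewrite -(cos_geodist sx sy) [RHS]leNgt ltr_cos -?leNgt//.
  by rewrite in_itv /= geodist_itv.
apply/seteqP; split=> y [sy /= yr]; split=> //.
  by rewrite /= in_itv /= andbT -capE.
by move: yr; rewrite in_itv /= andbT -capE.
Qed.

Lemma exists_unit_tangent x : (2 <= d)%N -> sphere x ->
  exists2 v, sphere v & dotv x v = 0.
Proof.
move=> d2 sx.
have [i [j ij]] : exists i j : 'I_d, i != j.
  by exists (Ordinal (ltnW d2)), (Ordinal d2).
suff [v v0 xv] : exists2 v, v != 0 & dotv x v = 0.
  have e0 : enorm v != 0.
    rewrite /enorm sqrtr_eq0 -ltNge lt_neqAle dotv_ge0 andbT eq_sym.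
    by apply: contra v0 => /eqP /dotv_eq0 ->.
  exists (normalize v); last by rewrite /normalize dotvZr xv mulr0.
  apply/sphereP; rewrite /normalize dotvZl dotvZr -[dotv v v]sqr_sqrtr ?dotv_ge0//.
  by rewrite -/(enorm v); field.
have [xi|xi] := eqVneq (x ord0 i) 0.
  exists (delta_mx ord0 i); last by rewrite dotvC dotv_delta.
  by apply/eqP => /rowP /(_ i); rewrite !mxE !eqxx => /eqP; rewrite oner_eq0.
exists (x ord0 j *: delta_mx ord0 i - x ord0 i *: delta_mx ord0 j).
  apply/eqP => /rowP /(_ j); rewrite !mxE !eqxx /= eq_sym (negbTE ij).
  by move=> /eqP; rewrite mulr0 sub0r mulr1 oppr_eq0 (negbTE xi).
by rewrite dotvBr !dotvZr !(dotvC x) !dotv_delta mulrC subrr.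
Qed.

Lemma great_circle_sphere x v t : sphere x -> sphere v -> dotv x v = 0 ->
  sphere (great_circle x v t).
Proof.
move=> /sphereP sx /sphereP sv xv; apply/sphereP; rewrite /great_circle.
rewrite !(dotvDl, dotvDr, dotvZl, dotvZr) sx sv (dotvC v) xv.
by have := cos2Dsin2 t; rewrite !expr2; lra.
Qed.

Lemma great_circle0 x v : great_circle x v 0 = x.
Proof. by rewrite /great_circle cos0 sin0 scale1r scale0r addr0. Qed.

Lemma dotv_eq1 x y : sphere x -> sphere y -> dotv x y = 1 -> x = y.
Proof.
move=> sx sy xy; apply/eqP; rewrite -subr_eq0; apply/eqP/dotv_eq0.
by have := chord2E sx sy; rewrite /chord2 xy => ->; lra.
Qed.

Lemma sphereN x : sphere x -> sphere (- x).
Proof. by move=> /sphereP sx; apply/sphereP; rewrite dotvNl dotvNr opprK. Qed.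

Lemma dotv_eqN1 x y : sphere x -> sphere y -> dotv x y = -1 -> y = - x.
Proof.
move=> sx sy xy; apply/esym/dotv_eq1 => //; first exact: sphereN.
by rewrite dotvNl xy opprK.
Qed.

(** A minimizing arc between non-antipodal points consists of nonnegative combinations of its ends,
    so a convex cone over [A] suffices. Antipodal points need a half great circle, whence the last
    condition; for boxes it is vacuous. *)
Lemma cone_geodesically_convex A : (2 <= d)%N -> A `<=` sphere ->
  (forall x y a b, A x -> A y -> 0 <= a -> 0 <= b ->
    sphere (a *: x + b *: y) -> A (a *: x + b *: y)) ->
  (forall x v t, A x -> A (- x) -> sphere v -> dotv x v = 0 ->
    A (great_circle x v t)) ->
  geodesically_convex A.
Proof.
move=> d2 As Ac AN x y Ax Ay; have sx := As _ Ax; have sy := As _ Ay.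
have /andP[g0 gpi] := geodist_itv sx sy.
have [xy1|xy1] := eqVneq (dotv x y) 1.
  have [v sv xv] := exists_unit_tangent d2 sx.
  exists v; rewrite /geodist xy1 acos1 great_circle0; split => //.
    exact: dotv_eq1.
  by move=> t t0; rewrite (_ : t = 0) ?great_circle0//; lra.
have [xyN|xyN] := eqVneq (dotv x y) (-1).
  have [v sv xv] := exists_unit_tangent d2 sx.
  have yE := dotv_eqN1 sx sy xyN.
  exists v; rewrite /geodist xyN acosN1; split => //.
    by rewrite /great_circle cospi sinpi scaleN1r scale0r addr0.
  by move=> t _; apply: AN => //; rewrite -yE.
have /andP[lo hi] := dotv_sphere_itv sx sy.
set th := geodist x y in g0 gpi *.
have cth : cos th = dotv x y := cos_geodist sx sy.
have sth : 0 < sin th.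
  apply: sin_gt0_pi; rewrite acos_gt0 ?acos_ltpi//.
  - by rewrite hi andbT lt_neqAle lo andbT eq_sym.
  - by rewrite lo lt_neqAle hi xy1.
have th2 := cos2Dsin2 th.
(* Gram-Schmidt: the unit tangent at [x] pointing towards [y]. *)
set v := (sin th)^-1 *: (y - cos th *: x).
have xv : dotv x v = 0.
  rewrite dotvZr dotvBr dotvZr cth; move/sphereP: sx => ->.
  by rewrite mulr1 subrr mulr0.
have vE : sin th *: v = y - cos th *: x by rewrite scalerA mulfV ?gt_eqF// scale1r.
have sv : sphere v.
  apply/sphereP; apply: (@mulfI _ (sin th ^+ 2)).
    by rewrite expf_neq0// gt_eqF.
  rewrite mulr1 {1}expr2 -mulrA -dotvZr -dotvZl vE.
  rewrite !(dotvBl, dotvBr, dotvZl, dotvZr) (dotvC y x) -cth.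
  by move/sphereP: sx => ->; move/sphereP: sy => ->; lra.
exists v; split => //.
  by rewrite /great_circle vE addrC subrK.
move=> t /andP[t0 tth]; have := great_circle_sphere t sx sv xv.
(* Spherical linear interpolation; both coefficients are nonnegative for [t] in [0, [th]]. *)
have -> : great_circle x v t = (sin (th - t) / sin th) *: x + (sin t / sin th) *: y.
  rewrite /great_circle /v scalerA scalerBr scalerA addrA [in LHS]addrAC -scalerBl.
  congr (_ *: _ + _); rewrite sinB; field; exact: lt0r_neq0.
apply: Ac => //; apply: divr_ge0; rewrite ?(ltW sth)//; apply: sin_ge0_pi.
  by rewrite subr_ge0 tth /=; lra.
by rewrite t0 /=; lra.
Qed.

(* Since caps have positive mass, this reduces disjointness of the interiors to *)
(* a null intersection.                                                         *)
Lemma interior_cap A B x : A `<=` sphere ->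
  (interior (A : set (subspace sphere)) `&`
   interior (B : set (subspace sphere))) x ->
  exists2 s : R, 0 < s <= pi & sphere x /\ cap x s `<=` A `&` B.
Proof.
move=> As [Ax Bx]; have sx : sphere x by apply: As; exact: (nbhs_singleton Ax).
have : nbhs (x : subspace sphere) (A `&` B) by apply: filterI.
rewrite /nbhs /= -nbhs_subspace_in// => /nbhs_ballP[e /= e0 h].
have ? := pi_gt0 R.
(* Half of [e] turns the non-strict bound of [cap_coord_le] into a strict one; radii up to pi are
   those for which caps are shown measurable. *)
exists (Num.min (e / 2) pi).
  by rewrite lt_min divr_gt0 ?pi_gt0 ?ltr0n ?ge_min ?lexx ?orbT.
split=> // y cy; apply: h; last by case: cy.
split=> // i j; rewrite (ord1 i) /ball /=.
apply: le_lt_trans (cap_coord_le j sx cy) _.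
by rewrite gt_min; apply/orP; left; rewrite ltr_pdivrMr// ltr_pMr// ltr1n.
Qed.

End sphere_geometry.

(** * Boxes in the central projection onto a facet *)

Section boxes.
Context {R : realType} {d : nat}.
Implicit Types (x y : 'rV[R]_d) (l : 'I_d * bool) (lo hi : 'I_d -> R).

Definition facev l : 'rV[R]_d := (-1) ^+ l.2 *: delta_mx ord0 l.1.

Definition height l x : R := (-1) ^+ l.2 * x ord0 l.1.

Lemma heightE l x : height l x = dotv (facev l) x.
Proof. by rewrite dotvZl dotv_delta. Qed.

Lemma sqr_height l x : height l x ^+ 2 = x ord0 l.1 ^+ 2.
Proof. by rewrite exprMn sqrr_sign mul1r. Qed.

Lemma height_comb l x y a b :
  height l (a *: x + b *: y) = a * height l x + b * height l y.
Proof. by rewrite !heightE dotvDr !dotvZr. Qed.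

(* The face with outer normal [facev l] of the cube is charted by the ratios *)
(* [x_j / height l x]; in this chart a box is a product of intervals.        *)
Definition box l lo hi : set 'rV[R]_d :=
  [set x | [/\ sphere x, 0 <= height l x & forall j, j != l.1 ->
    lo j * height l x <= x ord0 j <= hi j * height l x]].

(** The bound 2 fits the facets, whose parameters lie in [1/2, 1] and so have quotients in
    [1/2, 2]. *)
Definition box_bounded l lo hi :=
  forall j, j != l.1 -> -2 <= lo j /\ hi j <= 2.

Lemma height_le1 l x : sphere x -> height l x <= 1.
Proof.
move=> /sphereP sx; have := sqr_coord_le_dotv x l.1.
by rewrite -sqr_height sx; nra.
Qed.

(** Every coordinate is at most twice the height [h] in absolute value, so 1 = |x|^2 <= 4 d h^2. *)
Lemma height_lb l lo hi x : box_bounded l lo hi -> box l lo hi x ->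
  (2 * d%:R)^-1 <= height l x.
Proof.
move=> bd [/sphereP sx h0 hx].
have d1 : 1 <= d%:R :> R.
  by rewrite ler1n (leq_ltn_trans (leq0n l.1)).
have : dotv x x <= \sum_(i < d) (4 * height l x ^+ 2).
  apply: ler_sum => j _; rewrite -expr2; have [->|jl] := eqVneq j l.1.
    by rewrite sqr_height; have := sqr_ge0 (x ord0 l.1); lra.
  have [b1 b2] := bd _ jl; have /andP[x1 x2] := hx _ jl.
  have u1 : - (2 * height l x) <= x ord0 j by nra.
  have u2 : x ord0 j <= 2 * height l x by nra.
  nra.
rewrite sx sumr_const card_ord -mulr_natl => h1.
rewrite -[leLHS]mul1r ler_pdivrMr; last by lra.
nra.
Qed.

Lemma height_gt0 l lo hi x : box_bounded l lo hi -> box l lo hi x ->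
  0 < height l x.
Proof.
move=> bd bx; apply: lt_le_trans (height_lb bd bx).
by rewrite invr_gt0 mulr_gt0// ltr0n (leq_ltn_trans (leq0n l.1)).
Qed.

Lemma box_sub_sphere l lo hi : box l lo hi `<=` sphere.
Proof. by move=> x []. Qed.

Lemma measurable_halfspace (a : 'rV[R]_d) : measurable [set x | 0 <= dotv a x].
Proof.
rewrite (_ : [set x | _] = setT `&` dotv a @^-1` `[0, +oo[).
  exact: measurable_dotv.
by rewrite setTI; apply/seteqP; split => x /=; rewrite in_itv /= andbT.
Qed.

(** A common form for boxes and facet cells, from which measurability and relative closedness
    follow. *)
Definition polyhedral (I : finType) (a : I -> 'rV[R]_d) : set 'rV[R]_d :=
  sphere `&` \bigcap_i [set x | 0 <= dotv (a i) x].

Lemma measurable_polyhedral (I : finType) (a : I -> 'rV[R]_d) :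
  measurable (polyhedral a).
Proof.
apply: measurableI; first exact: measurable_sphere.
by apply: fin_bigcap_measurable => // i _; exact: measurable_halfspace.
Qed.

Lemma continuous_dotv (a : 'rV[R]_d) : continuous (dotv a).
Proof.
apply: (@continuous_big _ _ +%R 0 xpredT _ _ _ (fun i y => a ord0 i * y ord0 i)).
  exact: add_continuous.
move=> i _ x.
by apply: continuousM; [exact: cst_continuous|exact: coord_continuous].
Qed.

Lemma closed_polyhedral (I : finType) (a : I -> 'rV[R]_d) :
  closed (polyhedral a : set (subspace sphere)).
Proof.
apply/closed_subspaceP; exists (\bigcap_i [set x | 0 <= dotv (a i) x]).
  apply: closed_bigI => i _.
  rewrite (_ : [set x | _] = dotv (a i) @^-1` [set t | 0 <= t])//.
  by apply: closed_comp => [x _|]; [exact: continuous_dotv|exact: closed_ge].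
by rewrite /polyhedral setIAC setIid setIC.
Qed.

Definition box_normal l lo hi (k : 'I_d * bool) : 'rV[R]_d :=
  if k.1 == l.1 then facev l
  else if k.2 then delta_mx ord0 k.1 - lo k.1 *: facev l
  else hi k.1 *: facev l - delta_mx ord0 k.1.

Lemma box_polyhedral l lo hi : box l lo hi = polyhedral (box_normal l lo hi).
Proof.
apply/seteqP; split => x.
  move=> [sx h0 hx]; split => // k _ /=; rewrite /box_normal.
  case: eqVneq => [_|kl]; first by rewrite -heightE.
  have /andP[h1 h2] := hx _ kl.
  by case: k.2; rewrite dotvBl dotvZl dotv_delta -heightE subr_ge0.
move=> [sx hx]; split => //.
  by have := hx l I; rewrite /= /box_normal eqxx heightE.
move=> j jl; have := hx (j, true) I; have := hx (j, false) I.
rewrite /= /box_normal /= (negbTE jl) !dotvBl !(dotvZl _ (facev l)) dotv_delta -heightE.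
by rewrite !subr_ge0 => -> ->.
Qed.

Lemma measurable_box l lo hi : measurable (box l lo hi).
Proof. by rewrite box_polyhedral; exact: measurable_polyhedral. Qed.

Lemma closed_box l lo hi : closed (box l lo hi : set (subspace sphere)).
Proof. by rewrite box_polyhedral; exact: closed_polyhedral. Qed.

Lemma box_geodesically_convex l lo hi : (2 <= d)%N -> box_bounded l lo hi ->
  geodesically_convex (box l lo hi).
Proof.
move=> d2 bd; apply: cone_geodesically_convex => //.
- exact: box_sub_sphere.
- move=> x y a b [_ x0 hx] [_ y0 hy] a0 b0 sxy; split => //.
    by rewrite height_comb addr_ge0// mulr_ge0.
  move=> j jl; have /andP[x1 x2] := hx _ jl; have /andP[y1 y2] := hy _ jl.
  by rewrite height_comb !mxE; nra.
- move=> x v t /(height_gt0 bd) hx /(height_gt0 bd); rewrite heightE dotvNr.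
  by rewrite -heightE; lra.
Qed.

Definition box_center l lo hi : 'rV[R]_d :=
  normalize (\row_j if j == l.1 then (-1) ^+ l.2 else (lo j + hi j) / 2).

Lemma box_centerP l lo hi (p := box_center l lo hi) :
  [/\ sphere p, 0 < height l p & forall j, j != l.1 ->
    p ord0 j = (lo j + hi j) / 2 * height l p].
Proof.
rewrite {}/p /box_center; set q := \row_j _.
have hq : height l q = 1 by rewrite /height mxE eqxx -expr2 sqrr_sign.
have q0 : 0 < enorm q.
  rewrite /enorm sqrtr_gt0; apply: lt_le_trans (sqr_coord_le_dotv q l.1).
  by rewrite -sqr_height hq expr1n.
have hp : height l (normalize q) = (enorm q)^-1.
  by rewrite /normalize heightE dotvZr -heightE hq mulr1.
split.
- apply/sphereP; rewrite /normalize dotvZl dotvZr -[dotv q q]sqr_sqrtr ?dotv_ge0//.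
  by rewrite -/(enorm q); field; exact: lt0r_neq0.
- by rewrite hp invr_gt0.
- by move=> j jl; rewrite hp !mxE (negbTE jl) mulrC.
Qed.

(** The centre is at least [rho]/2 times its height away from each wall, which is at least 3r by
    [height_lb]. Moving by r changes the coordinate by at most r and the wall value
    [lo j * height l] or [hi j * height l] by at most 2r. *)
Lemma cap_sub_box l lo hi (rho r : R) : box_bounded l lo hi ->
  (forall j, j != l.1 -> lo j + rho <= hi j) -> 0 < r -> 12 * d%:R * r <= rho ->
  rho <= 1 -> cap (box_center l lo hi) r `<=` box l lo hi.
Proof.
move=> bd wd r0 rrho rho1 y cy; have [sp hp0 hp] := box_centerP l lo hi.
set p := box_center l lo hi in sp hp0 hp cy *.
have d1 : 1 <= d%:R :> R.
  by rewrite ler1n (leq_ltn_trans (leq0n l.1)).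
have rho0 : 0 < rho by apply: lt_le_trans rrho; rewrite !mulr_gt0//; lra.
have bp : box l lo hi p.
  split => // [|j jl]; first exact: ltW.
  by rewrite hp// !ler_pM2r//; have := wd _ jl; lra.
have hlb := height_lb bd bp.
have yp := cap_coord_le _ sp cy.
have hyp : `|height l p - height l y| <= r.
  by rewrite /height -mulrBr normrM normr_sign mul1r.
have dr : 6 * r <= rho * height l p.
  apply: le_trans (_ : rho * (2 * d%:R)^-1 <= _); last by rewrite ler_pM2l.
  by rewrite ler_pdivlMr; lra.
move: hyp; rewrite ler_norml => /andP[h1 h2].
split; [by case: cy|by nra|move=> j jl].
have := yp j; rewrite ler_norml hp// => /andP[y1 y2].
have [b1 b2] := bd _ jl; have w := wd _ jl.
have e1 : (hi j - lo j) * height l p >= rho * height l p by rewrite ler_pM2r//; lra.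
apply/andP; split.
  have : lo j * (height l y - height l p) <= 2 * r by nra.
  nra.
have : hi j * (height l p - height l y) <= 2 * r by nra.
nra.
Qed.

(** The multiples [b *: x] and [a *: y] have equal height [a * b], and there the box is Euclidean
    with sides at most 3 [rho] times [a * b]. *)
Lemma box_chord2 l lo hi (rho : R) x y : box_bounded l lo hi ->
  (forall j, j != l.1 -> hi j <= lo j + 3 * rho) -> 0 <= rho ->
  box l lo hi x -> box l lo hi y -> chord2 x y <= 9 * d%:R * rho ^+ 2.
Proof.
move=> bd wd rho0 bx by_; have a0 := height_gt0 bd bx; have b0 := height_gt0 bd by_.
have [sx _ hx] := bx; have [sy _ hy] := by_.
have a1 := height_le1 l sx; have b1 := height_le1 l sy.
set a := height l x in a0 a1 hx *; set b := height l y in b0 b1 hy *.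
have key : dotv (b *: x - a *: y) (b *: x - a *: y) <=
    9 * d%:R * rho ^+ 2 * (a * b) ^+ 2.
  apply: (@le_trans _ _ (\sum_(i < d) (9 * rho ^+ 2 * (a * b) ^+ 2))).
    apply: ler_sum => j _; rewrite -expr2 !mxE; have [->|jl] := eqVneq j l.1.
      rewrite (_ : _ - _ = 0).
        by rewrite expr0n /=; have := sqr_ge0 (rho * (a * b)); lra.
      by rewrite /a /b /height; ring.
    have /andP[x1 x2] := hx _ jl; have /andP[y1 y2] := hy _ jl; have w := wd _ jl.
    have ab0 : 0 < a * b by exact: mulr_gt0.
    have u1 : b * x ord0 j - a * y ord0 j <= 3 * rho * (a * b) by nra.
    have u2 : - (3 * rho * (a * b)) <= b * x ord0 j - a * y ord0 j by nra.
    nra.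
  by rewrite sumr_const card_ord -[leLHS]mulr_natl; lra.
have ab0 : 0 < (a * b) ^+ 2 by rewrite exprn_gt0// mulr_gt0.
rewrite -(ler_pM2r ab0); apply: le_trans key; rewrite chord2E//.
have /andP[_ c1] := dotv_sphere_itv sx sy.
rewrite !(dotvBl, dotvBr, dotvZl, dotvZr) (dotvC y x).
move/sphereP: sx => ->; move/sphereP: sy => ->; set c := dotv x y in c1 *.
have ab1 : a * b <= 1 by nra.
(* The squared distance of the multiples is (a-b)^2 + 2ab(1-c), which is at least (ab)^2 (2-2c)
   because ab <= 1. *)
have : 0 <= (1 - c) * (1 - a * b) * (a * b).
  apply: mulr_ge0; last by apply: ltW; exact: mulr_gt0.
  by apply: mulr_ge0; rewrite subr_ge0.
have := sqr_ge0 (a - b); lra.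
Qed.

Lemma box_sub_cap l lo hi (rho : R) : box_bounded l lo hi ->
  (forall j, j != l.1 -> lo j <= hi j <= lo j + 3 * rho) -> 0 <= rho ->
  box l lo hi `<=` cap (box_center l lo hi) (12 * d%:R * rho).
Proof.
move=> bd wd rho0 y by_; have [sp hp0 hp] := box_centerP l lo hi.
set p := box_center l lo hi in sp hp0 hp *.
have d1 : 1 <= d%:R :> R.
  by rewrite ler1n (leq_ltn_trans (leq0n l.1)).
have bp : box l lo hi p.
  split => // [|j jl]; first exact: ltW.
  by rewrite hp// !ler_pM2r//; have := wd _ jl; lra.
have sy := box_sub_sphere by_; split => //.
have wd' j : j != l.1 -> hi j <= lo j + 3 * rho by move=> /wd /andP[].
have := box_chord2 bd wd' rho0 bp by_.
have := geodist_le_chord2 sp sy; have /andP[g0 _] := geodist_itv sp sy.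
move=> g1 g2; rewrite -(@ler_pXn2r _ 2) ?nnegrE//; last by rewrite !mulr_ge0//; lra.
apply: le_trans g1 _; apply: (@le_trans _ _ (144 * d%:R * rho ^+ 2)); first lra.
have := sqr_ge0 rho; nra.
Qed.

End boxes.

(** * Cutting an integral box into small integral boxes *)

Section slicing.
Context {R : realType} {d : nat} (nu : {measure set 'rV[R]_d -> \bar R}).
Context (nu_fin : (nu setT < +oo)%E)
  (nu_hyperplane : forall a, a != 0 -> nu [set x | dotv a x = 0] = 0%E)
  (N : nat) (N_gt0 : (0 < N)%N) (r rho : R) (r_itv : 0 < r <= pi)
  (r_rho : 12 * d%:R * r <= rho) (rho_gt0 : 0 < rho) (rho_le1 : rho <= 1)
  (cap_mass : forall x, sphere x -> N%:R^-1 <= rmass nu (cap x r)).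
Implicit Types (A : set 'rV[R]_d) (l : 'I_d * bool) (lo hi : 'I_d -> R).

Definition wide l lo hi := forall j, j != l.1 -> lo j + rho <= hi j.

Definition integral_mass A := exists k : nat, N%:R * rmass nu A = k%:R.

Let N0 : 0 < N%:R :> R. Proof. by rewrite ltr0n. Qed.

Lemma le_box_mass l lo hi : box_bounded l lo hi -> wide l lo hi ->
  N%:R^-1 <= rmass nu (box l lo hi).
Proof.
move=> bd wd; have [sp _ _] := box_centerP l lo hi.
have /andP[r0 rpi] := r_itv.
apply: le_trans (cap_mass sp) _; apply: le_rmass => //.
- by apply: measurable_cap => //; rewrite (ltW r0).
- exact: measurable_box.
- exact: (cap_sub_box bd wd).
Qed.

Lemma null_box_wall A l (j : 'I_d) t : j != l.1 -> measurable A ->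
  (forall x : 'rV[R]_d, A x -> x ord0 j = t * height l x) -> nu A = 0%E.
Proof.
move=> jl mA At; pose a : 'rV[R]_d := delta_mx ord0 j - t *: facev l.
have a0 : a != 0.
  apply/eqP => /rowP /(_ j); rewrite !mxE !eqxx /= (negbTE jl) !mulr0 subr0.
  by move/eqP; rewrite oner_eq0.
apply: (null_sub mA (measurable_hyperplane a 0) _ (nu_hyperplane a0)) => x Ax /=.
by rewrite dotvBl (dotvZl t) dotv_delta -heightE At// subrr.
Qed.

Definition upd (f : 'I_d -> R) j t : 'I_d -> R :=
  fun k => if k == j then t else f k.

Lemma box_cut l lo hi j t : j != l.1 -> lo j <= t <= hi j ->
  box l lo hi = box l lo (upd hi j t) `|` box l (upd lo j t) hi.
Proof.
move=> jl /andP[lot thi]; apply/seteqP; split => x.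
  move=> [sx h0 hx].
  have [xt|tx] := leP (x ord0 j) (t * height l x); [left|right].
    split=> // k kl; rewrite /upd; case: eqVneq => [->|_]; last exact: hx.
    by have /andP[-> _] := hx _ jl.
  split=> // k kl; rewrite /upd; case: eqVneq => [->|_]; last exact: hx.
  by rewrite (ltW tx); have /andP[_ ->] := hx _ jl.
move=> [|] [sx h0 hx]; split=> // k kl; have := hx _ kl; rewrite /upd;
  case: eqVneq => [->|_//] /andP[x1 x2].
- by rewrite x1 (le_trans x2)// ler_wpM2r.
- by rewrite x2 andbT; apply: le_trans x1; rewrite ler_wpM2r.
Qed.

Lemma box_cut_null l lo hi j t : j != l.1 ->
  nu (box l lo (upd hi j t) `&` box l (upd lo j t) hi) = 0%E.
Proof.
move=> jl; apply: (@null_box_wall _ l j t) => //.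
  by apply: measurableI; exact: measurable_box.
move=> x [[_ _ h1] [_ _ h2]]; have := h1 _ jl; have := h2 _ jl.
rewrite /upd eqxx => /andP[x1 _] /andP[_ x2].
by apply/le_anti; rewrite x1 x2.
Qed.

Lemma box_cut_mass l lo hi j t : j != l.1 -> lo j <= t <= hi j ->
  rmass nu (box l lo hi) =
  rmass nu (box l lo (upd hi j t)) + rmass nu (box l (upd lo j t) hi).
Proof.
move=> jl tj; rewrite (box_cut jl tj).
apply: rmassU => //; [exact: measurable_box|exact: measurable_box|].
exact: box_cut_null.
Qed.

Lemma bounded_upd_hi l lo hi j t : box_bounded l lo hi -> j != l.1 -> t <= hi j ->
  box_bounded l lo (upd hi j t).
Proof.
move=> bd jl th k kl; have [b1 b2] := bd _ kl; rewrite /upd.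
by case: eqVneq => [kj|//]; split => //; apply: le_trans th _; rewrite -kj.
Qed.

Lemma bounded_upd_lo l lo hi j t : box_bounded l lo hi -> j != l.1 -> lo j <= t ->
  box_bounded l (upd lo j t) hi.
Proof.
move=> bd jl th k kl; have [b1 b2] := bd _ kl; rewrite /upd.
by case: eqVneq => [kj|//]; split => //; apply: le_trans th; rewrite -kj.
Qed.

Lemma wide_upd_hi l lo hi j t : wide l lo hi -> lo j + rho <= t ->
  wide l lo (upd hi j t).
Proof. by move=> wd h k kl; rewrite /upd; case: eqVneq => [->//|_]; exact: wd. Qed.

Lemma wide_upd_lo l lo hi j t : wide l lo hi -> t + rho <= hi j ->
  wide l (upd lo j t) hi.
Proof. by move=> wd h k kl; rewrite /upd; case: eqVneq => [->//|_]; exact: wd. Qed.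

Lemma le_box_massn n l lo hi j : box_bounded l lo hi -> wide l lo hi ->
  j != l.1 -> lo j + n%:R * rho <= hi j -> n%:R / N%:R <= rmass nu (box l lo hi).
Proof.
(* The induction bottoms out at one slab, which absorbs the leftover width; a remainder of width
   below [rho] would not be [wide]. *)
elim: n lo => [|[|n] IH] lo bd wd jl hn.
- by rewrite mul0r rmass_ge0.
- by rewrite mul1r le_box_mass.
have n1 : n.+2%:R = n.+1%:R + 1 :> R by rewrite -natr1.
have n0 : 0 <= n%:R :> R by [].
have n2 : n.+1%:R = n%:R + 1 :> R by rewrite -natr1.
have nr : 0 <= n%:R * rho by rewrite mulr_ge0// ltW.
have r0 := rho_gt0.
move: hn; rewrite n1 n2 => hn.
have t1 : lo j <= lo j + rho <= hi j by lra.
rewrite (box_cut_mass jl t1) -n2 mulrDl addrC mul1r lerD//.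
  apply: le_box_mass; last exact: wide_upd_hi.
  by apply: bounded_upd_hi => //; case/andP: t1.
apply: IH => //.
- by apply: bounded_upd_lo => //; case/andP: t1.
- by apply: wide_upd_lo => //; lra.
- by rewrite /upd eqxx n2; lra.
Qed.

Lemma box_mass_continuous l lo hi j : j != l.1 ->
  continuous (fun t => rmass nu (box l lo (upd hi j t))).
Proof.
move=> jl t.
(* The null set is the wall at [t], written as a box with both [j]-bounds equal to [t]. *)
apply: (@rmass_continuous _ _ _ _ nu_fin (fun t => box l lo (upd hi j t))
  (box l (upd lo j t) (upd hi j t)) t).
- by move=> s; exact: measurable_box.
- move=> s s' ss' x [sx h0 hx]; split=> // k kl; have := hx _ kl; rewrite /upd.
  by case: eqVneq => // _ /andP[-> x2]; rewrite (le_trans x2)// ler_wpM2r.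
- move=> x hx; have [|sx h0 hx1] := hx (t + 1); first by rewrite ltrDl.
  split=> // k kl; have := hx1 _ kl; rewrite /upd; case: eqVneq => // kj /andP[-> _] /=.
  apply/ler_addgt0Pr => e e0; have [|_ _ /(_ j jl)] := hx (t + e); first by rewrite ltrDl.
  rewrite /upd eqxx mulrDl kj => /andP[_] /le_trans; apply; rewrite lerD2l.
  by rewrite ler_piMr ?(ltW e0)// height_le1.
- exact: measurable_box.
- apply: (@null_box_wall _ l j t) => //; first exact: measurable_box.
  move=> x [_ _ /(_ j jl)]; rewrite /upd eqxx => xt.
  by apply/le_anti; rewrite andbC.
- move=> x [sx h0 hx] nx.
  have := hx _ jl; rewrite /upd eqxx => /andP[x1 x2].
  have xt : x ord0 j < t * height l x.
    rewrite lt_neqAle x2 andbT; apply: contra_notN nx => /eqP xE.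
    split=> // k kl; rewrite /upd; case: eqVneq => [->|kj].
      by rewrite xE lexx.
    by have := hx _ kl; rewrite /upd (negbTE kj).
  have hpos : 0 < height l x.
    rewrite lt_neqAle h0 andbT; apply/eqP => h00.
    by move: x1 xt; rewrite -h00 !mulr0; lra.
  exists (x ord0 j / height l x); first by rewrite ltr_pdivrMr.
  split=> // k kl; rewrite /upd; case: eqVneq => [->|kj].
    by rewrite x1 divfK ?lexx// gt_eqF.
  by have := hx _ kl; rewrite /upd (negbTE kj).
Qed.

(** The side 3 [rho] leaves [rho] for each half and [rho] for the cut to travel; along the way it
    sweeps out a wide box, worth at least one unit. *)
Lemma exists_integral_cut l lo hi j : box_bounded l lo hi -> wide l lo hi ->
  j != l.1 -> lo j + 3 * rho <= hi j -> integral_mass (box l lo hi) ->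
  exists t, [/\ lo j + rho <= t, t + rho <= hi j,
    integral_mass (box l lo (upd hi j t)) & integral_mass (box l (upd lo j t) hi)].
Proof.
move=> bd wd jl w3 [K mK]; have r0 := rho_gt0.
pose f t := N%:R * rmass nu (box l lo (upd hi j t)).
pose a := lo j + rho; pose b := a + rho.
have ab : a <= b by rewrite lerDl ltW.
have bh : b + rho <= hi j by rewrite /b /a; lra.
have fa0 : 0 <= f a by rewrite mulr_ge0 ?rmass_ge0// ltW.
have fab : f a + 1 <= f b.
  have ta : lo j <= a <= (upd hi j b) j by rewrite /upd eqxx ab andbT lerDl ltW.
  rewrite /f (@box_cut_mass l lo (upd hi j b) j a jl ta) mulrDr lerD//.
    rewrite (_ : upd (upd hi j b) j a = upd hi j a)//.
    by apply/funext => k; rewrite /upd; case: eqP.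
  rewrite -[leLHS](mulfV (lt0r_neq0 N0)) ler_wpM2l ?(ltW N0)//.
  apply: le_box_mass.
    apply: bounded_upd_lo => //; last by case/andP: ta.
    by apply: bounded_upd_hi => //; lra.
  apply: wide_upd_lo; last by rewrite /upd eqxx.
  by apply: wide_upd_hi => //; rewrite -/a.
(* The least integer above [f a]; it is at most [f a + 1], hence at most [f b]. *)
pose k := (Num.truncn (f a)).+1.
have /andP[k1 k2] := truncn_itv fa0.
have k3 : k%:R = (Num.truncn (f a))%:R + 1 :> R by rewrite -natr1.
have [||t] := @IVT R f a b k%:R ab.
- apply: continuous_subspaceT => x; apply: cvgMr; exact: box_mass_continuous.
- rewrite ge_min le_max; apply/andP; split; apply/orP; [left|right].
    exact: ltW.
  by rewrite k3; lra.
rewrite in_itv /= => /andP[at_ tb] ft; exists t; split => //; first lra.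
  by exists k.
have tlh : lo j <= t <= hi j by move: at_; rewrite /a; lra.
exists (K - k)%N; have := mK; rewrite (box_cut_mass jl tlh) mulrDr -/(f t) ft => mE.
have kK : (k <= K)%N.
  by rewrite -(ler_nat R) -mE lerDl mulr_ge0 ?rmass_ge0// ltW.
by rewrite natrB// -mE addrC addKr.
Qed.

(** [n] is fuel: a cut leaves each half a sum of sides smaller by at least [rho]. With no fuel the
    sum is at most 0, so no side can be long. *)
Lemma exists_fine_cells l n lo hi : box_bounded l lo hi -> wide l lo hi ->
  integral_mass (box l lo hi) ->
  \sum_(j | j != l.1) (hi j - lo j) <= n%:R * rho ->
  exists (I : finType) (lo' hi' : I -> 'I_d -> R),
  [/\ forall i, [/\ box_bounded l (lo' i) (hi' i), wide l (lo' i) (hi' i),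
        forall j, j != l.1 -> hi' i j <= lo' i j + 3 * rho &
        integral_mass (box l (lo' i) (hi' i))],
      box l lo hi = \bigcup_i box l (lo' i) (hi' i) &
      forall i j, i != j ->
        nu (box l (lo' i) (hi' i) `&` box l (lo' j) (hi' j)) = 0%E].
Proof.
have r0 := rho_gt0; elim: n lo hi => [|n IH] lo hi bd wd im sn.
all: have [/existsP[j /andP[jl w3]]|/existsPn w3] :=
  boolP [exists j, (j != l.1) && (lo j + 3 * rho < hi j)]; last first.
- exists unit, (fun=> lo), (fun=> hi); split=> [_| |[] []//].
    by split=> // j jl; have := w3 j; rewrite jl /= -leNgt.
  by apply/seteqP; split=> x; [exists tt|case].
- have : hi j - lo j <= \sum_(j | j != l.1) (hi j - lo j).
    rewrite (bigD1 j)//= lerDl sumr_ge0// => k /andP[kl _].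
    by have := wd _ kl; lra.
  lra.
- exists unit, (fun=> lo), (fun=> hi); split=> [_| |[] []//].
    by split=> // j jl; have := w3 j; rewrite jl /= -leNgt.
  by apply/seteqP; split=> x; [exists tt|case].
have [t [lot thi im1 im2]] := exists_integral_cut bd wd jl (ltW w3) im.
have lth : lo j <= t <= hi j by lra.
have sE : \sum_(j | j != l.1) (hi j - lo j) =
    hi j - lo j + \sum_(k | (k != l.1) && (k != j)) (hi k - lo k).
  by rewrite (bigD1 j).
have n1 : n.+1%:R = n%:R + 1 :> R by rewrite -natr1.
have [||||I1 [lo1 [hi1 [g1 u1 d1]]]] := IH lo (upd hi j t).
- by apply: bounded_upd_hi => //; lra.
- exact: wide_upd_hi.
- exact: im1.
- rewrite (bigD1 j)//= {1}/upd eqxx.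
  rewrite (eq_bigr (fun k => hi k - lo k)); last first.
    by move=> k /andP[_ /negbTE kj]; rewrite /upd kj.
  by move: sn; rewrite sE n1; lra.
have [||||I2 [lo2 [hi2 [g2 u2 d2]]]] := IH (upd lo j t) hi.
- by apply: bounded_upd_lo => //; lra.
- exact: wide_upd_lo.
- exact: im2.
- rewrite (bigD1 j)//= {1}/upd eqxx.
  rewrite (eq_bigr (fun k => hi k - lo k)); last first.
    by move=> k /andP[_ /negbTE kj]; rewrite /upd kj.
  by move: sn; rewrite sE n1; lra.
have d12 i k : nu (box l (lo1 i) (hi1 i) `&` box l (lo2 k) (hi2 k)) = 0%E.
  apply: null_sub (box_cut_null lo hi t jl);
    try by apply: measurableI; exact: measurable_box.
  by rewrite u1 u2; apply: setISS => x bx; [exists i|exists k].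
exists (I1 + I2)%type,
  (fun s => match s with inl i => lo1 i | inr i => lo2 i end),
  (fun s => match s with inl i => hi1 i | inr i => hi2 i end).
split.
- by case.
- rewrite (box_cut jl lth) u1 u2; apply/seteqP; split=> x.
    by move=> [[i _ bx]|[i _ bx]]; [exists (inl i)|exists (inr i)].
  by move=> [[i|i] _ bx]; [left|right]; exists i.
- move=> [i|i] [k|k] ik; [exact: d1|exact: d12|by rewrite setIC d12|exact: d2].
Qed.

End slicing.

(** * Facet distances that make every facet integral *)

Section balancing.
Context {R : realType} {d : nat} (nu : {measure set 'rV[R]_d -> \bar R}).
Context (nu_fin : (nu setT < +oo)%E)
  (nu_hyperplane : forall a, a != 0 -> nu [set x | dotv a x = 0] = 0%E)
  (N : nat) (N_gt0 : (0 < N)%N) (r rho : R) (r_itv : 0 < r <= pi)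
  (r_rho : 12 * d%:R * r <= rho) (rho_gt0 : 0 < rho)
  (d_gt1 : (1 < d)%N) (d_rho : 9 * d%:R * rho <= 1)
  (sphere_mass : rmass nu sphere = 1)
  (cap_mass : forall x, sphere x -> N%:R^-1 <= rmass nu (cap x r)).
Local Notation face := ('I_d * bool)%type.
Implicit Types (x : 'rV[R]_d) (A : set 'rV[R]_d) (l k : face) (b c : face -> R).

Let N0 : 0 < N%:R :> R. Proof. by rewrite ltr0n. Qed.

Let d2 : 2 <= d%:R :> R. Proof. by rewrite ler_nat. Qed.

Let rho12 : 12 * rho <= 1.
Proof. by have r0 := rho_gt0; have d1 := d2; have d9 := d_rho; nra. Qed.

(* The cones over the facets of the box with facet distances [1 / b k]. *)
Definition cell b l : set 'rV[R]_d :=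
  [set x | [/\ sphere x, 0 <= height l x &
    forall k, b k * height k x <= b l * height l x]].

Lemma neg_face_neq l : (l.1, ~~ l.2) != l.
Proof. by case: l => i []; rewrite xpair_eqE eqxx. Qed.

Lemma height_opp l k x : k.1 = l.1 -> k != l -> height k x = - height l x.
Proof.
case: l k => i s [j t] /= ->; rewrite xpair_eqE eqxx /= /height /=.
by case: s t => [] [] // _; rewrite ?expr0 ?expr1; lra.
Qed.

Lemma cell_polyhedral b l : cell b l = polyhedral (fun k =>
  if k == l then facev l else b l *: facev l - b k *: facev k).
Proof.
apply/seteqP; split=> x.
  move=> [sx h0 hx]; split=> // k _ /=; case: eqVneq => [_|kl].
    by rewrite -heightE.
  by rewrite dotvBl !(dotvZl (b _)) -!heightE subr_ge0.
move=> [sx hx]; have h0 : 0 <= height l x.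
  by have := hx l I; rewrite /= eqxx heightE.
split=> // k; have [->//|kl] := eqVneq k l.
have := hx k I; rewrite /= (negbTE kl) dotvBl !(dotvZl (b _)) -!heightE.
by rewrite subr_ge0.
Qed.

Lemma measurable_cell b l : measurable (cell b l).
Proof. by rewrite cell_polyhedral; exact: measurable_polyhedral. Qed.

(** The faces [(j, true)] and [(j, false)] give the two bounds on coordinate [j]; the face opposite
    to [l] gives nothing new. So the slicing applies to cells. *)
Lemma cell_box b l : (forall k, 0 < b k) -> cell b l =
  box l (fun j => - (b l / b (j, true))) (fun j => b l / b (j, false)).
Proof.
move=> b0; apply/seteqP; split=> x [sx h0 hx]; split=> //.
  move=> j jl; have := hx (j, true); have := hx (j, false).
  rewrite {1 3}/height /= expr0 expr1 mul1r mulN1r => h1 h2.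
  rewrite mulNr lerNl ![b l / _ * _]mulrAC; apply/andP; split.
    by rewrite ler_pdivlMr// mulrC.
  by rewrite ler_pdivlMr// mulrC.
move=> k; have [kl|kl] := eqVneq k.1 l.1.
  have [->//|kl2] := eqVneq k l.
  rewrite (height_opp _ kl kl2); have := b0 k; have := b0 l; nra.
have := hx _ kl; rewrite mulNr lerNl ![b l / _ * _]mulrAC !ler_pdivlMr// => /andP[h1 h2].
case: k kl h1 h2 => j [] /= jl h1 h2; rewrite {1}/height /= ?expr0 ?expr1 mulrC.
  by rewrite mulN1r.
by rewrite mul1r.
Qed.

Lemma null_cellI b l k : (forall k, 0 < b k) -> l != k ->
  nu (cell b l `&` cell b k) = 0%E.
Proof.
move=> b0 lk; have mI : measurable (cell b l `&` cell b k).
  by apply: measurableI; exact: measurable_cell.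
pose a : 'rV[R]_d := b l *: facev l - b k *: facev k.
have aE x : dotv a x = b l * height l x - b k * height k x.
  by rewrite dotvBl !(dotvZl (b _)) -!heightE.
have a0 : a != 0.
  apply: contraNneq lk => a0; apply/negPn/negP => lk.
  have : dotv a (facev l) = 0.
    by rewrite a0 -(scale0r (0 : 'rV_d)) (dotvZl 0) mul0r.
  have hl : height l (facev l) = 1 :> R.
    by rewrite /height /facev !mxE !eqxx mulr1 -expr2 sqrr_sign.
  rewrite aE hl; have [kl|kl] := eqVneq k.1 l.1.
    have bl := b0 l; have bk := b0 k.
    by rewrite (height_opp _ kl) 1?eq_sym// hl; lra.
  rewrite {1}/height /facev !mxE (negbTE kl) andbF !mulr0 subr0 mulr1.
  by move=> bl0; have := b0 l; rewrite bl0 ltxx.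
apply: (null_sub mI (measurable_hyperplane a 0) _ (nu_hyperplane a0)).
move=> x [[_ _ h1] [_ _ h2]]; rewrite /= aE.
by apply/eqP; rewrite subr_eq0; apply/eqP/le_anti; rewrite h1 h2.
Qed.

Lemma bigcup_cell b : (forall k, 0 < b k) -> sphere = \bigcup_l cell b l.
Proof.
move=> b0; apply/seteqP; split=> [x sx|x [l _ []]//].
pose l0 : face := (Ordinal d_gt1, false).
pose l := [arg max_(l > l0) (b l * height l x)]%O.
have lP k : b k * height k x <= b l * height l x.
  by rewrite /l; case: arg_maxP => // i _; apply.
exists l => //; split=> //.
(* The maximum is at least the value at the opposite face, whose height is the negative, so the
   height of [l] is nonnegative. *)
have := lP (l.1, ~~ l.2); rewrite (@height_opp l) ?neg_face_neq//.
have := b0 l; have := b0 (l.1, ~~ l.2); nra.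
Qed.

Lemma sum_cell_mass b : (forall k, 0 < b k) -> \sum_l rmass nu (cell b l) = 1.
Proof.
move=> b0; rewrite -sphere_mass (bigcup_cell b0) rmass_bigcup// => [l|l k].
  exact: measurable_cell.
exact: null_cellI.
Qed.

(** The monotonicity behind the extremal argument: facet [l] grows when the other parameters drop.
    Faces of negative height impose no constraint. *)
Lemma cell_sub b c l : (forall k, 0 <= c k <= b k) -> c l = b l ->
  cell b l `<=` cell c l.
Proof.
move=> cb cl x [sx h0 hx]; split=> // k; rewrite cl; have := hx k.
have /andP[c0 ck] := cb k; have /andP[cl0 /(le_trans cl0) bl] := cb l.
have [hk|hk] := leP 0 (height k x); first by apply: le_trans; rewrite ler_wpM2r.
move=> _; apply: (@le_trans _ _ 0); last exact: mulr_ge0.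
exact: mulr_ge0_le0 c0 (ltW hk).
Qed.

Definition updb b l t : face -> R := fun k => if k == l then t else b k.

Lemma cell_updb_le b l s t : s <= t -> cell (updb b l s) l `<=` cell (updb b l t) l.
Proof.
move=> st x [sx h0 hx]; split=> // k; have := hx k; rewrite /updb eqxx.
by case: eqVneq => [->//|_] /le_trans; apply; rewrite ler_wpM2r.
Qed.

(** The null set is the overlap with the other cells. Off it, facet [l] strictly beats its best
    competitor, which leaves room to lower its parameter. *)
Lemma cell_mass_continuous b l t : (forall k, 0 < b k) -> 0 < t ->
  {for t, continuous (fun s => rmass nu (cell (updb b l s) l))}.
Proof.
move=> b0 t0; pose B := updb b l t.
have B0 k : 0 < B k by rewrite /B /updb; case: ifP.
pose F k := if k == l then set0 else cell B l `&` cell B k.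
have mF k : measurable (F k).
  by rewrite /F; case: ifP => // _; apply: measurableI; exact: measurable_cell.
have F0 k : nu (F k) = 0%E.
  by rewrite /F; case: eqVneq => [_|kl]; rewrite ?measure0// null_cellI// eq_sym.
apply: (@rmass_continuous _ _ _ _ nu_fin (fun s => cell (updb b l s) l) (\bigcup_k F k)).
- by move=> s; exact: measurable_cell.
- by move=> s s'; exact: cell_updb_le.
- move=> x hx; have [|sx h0 _] := hx (t + 1); first by rewrite ltrDl.
  split=> // k; rewrite /updb eqxx; case: eqVneq => [->//|kl].
  apply/ler_addgt0Pr => e e0; have [|_ _ /(_ k)] := hx (t + e); first by rewrite ltrDl.
  rewrite /updb eqxx (negbTE kl) mulrDl => /le_trans; apply; rewrite lerD2l.
  by rewrite ler_piMr ?(ltW e0)// height_le1.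
- by apply: fin_bigcup_measurable.
- rewrite -(rmassK nu_fin); last exact: fin_bigcup_measurable.
  rewrite rmass_bigcup//.
    by rewrite big1// => k _; rewrite /rmass F0.
  move=> i k _; apply: (@null_sub _ _ _ _ _ (F i)) => //; exact: measurableI.
- move=> x [sx h0 hx] nx.
  have xlt k : k != l -> b k * height k x < t * height l x.
    move=> kl; have := hx k; rewrite /updb eqxx (negbTE kl) => hk.
    rewrite lt_neqAle hk andbT; apply: contra_notN nx => /eqP xE.
    exists k => //; rewrite /F (negbTE kl); split=> //; split=> //.
      have : 0 <= b k * height k x by rewrite xE mulr_ge0// ltW.
      by rewrite pmulr_rge0.
    by move=> k'; have := hx k'; rewrite /B /updb eqxx (negbTE kl) xE.
  pose l' : face := (l.1, ~~ l.2).
  have ll' : l' != l := neg_face_neq l.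
  have hpos : 0 < height l x.
    rewrite lt_neqAle h0 andbT; apply/eqP => h00.
    by have := xlt _ ll'; rewrite (@height_opp l)// -h00 oppr0 !mulr0 ltxx.
  pose k := [arg max_(k > l' | k != l) (b k * height k x)]%O.
  have [kl kP] : k != l /\ forall k', k' != l -> b k' * height k' x <= b k * height k x.
    by rewrite /k; case: arg_maxP.
  exists (b k * height k x / height l x); first by rewrite ltr_pdivrMr// xlt.
  split=> // k'; rewrite /updb eqxx; case: eqVneq => [->//|k'l].
  by rewrite divfK ?gt_eqF// kP.
Qed.

(* [u <= height k x / height l x <= v]: the sign [k.2] swaps the two bounds. *)
Definition strip l k (u v : R) := box l
  (fun j => if j == k.1 then if k.2 then - v else u else - (1 / 2))
  (fun j => if j == k.1 then if k.2 then - u else v else 1 / 2).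

Lemma strip_mass n l k u v : k.1 != l.1 -> -2 <= u -> v <= 2 ->
  u + n%:R * rho <= v -> (0 < n)%N -> n%:R / N%:R <= rmass nu (strip l k u v).
Proof.
move=> kl u2 v2 uv n0; have r1 := rho12; have r0 := rho_gt0.
have n1 : rho <= n%:R * rho by rewrite ler_peMl ?(ltW r0)// ler1n.
have rle1 : rho <= 1 by lra.
apply: (le_box_massn nu_fin nu_hyperplane r_itv r_rho rho_gt0 rle1 cap_mass _ _ kl).
- by move=> j jl /=; case: ifP => [_|_]; [case: k.2|]; split; lra.
- by move=> j jl /=; case: ifP => [_|_]; [case: k.2|]; lra.
- by rewrite eqxx; case: k.2; lra.
Qed.

Lemma strip_height l k u v x : k.1 != l.1 -> strip l k u v x ->
  [/\ sphere x, 0 <= height l x,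
    u * height l x <= height k x <= v * height l x &
    forall k', k'.1 != k.1 -> k'.1 != l.1 -> height k' x <= height l x / 2].
Proof.
move=> kl [sx h0 hx]; split=> //.
  have := hx _ kl; rewrite eqxx [height k x]/height.
  by case: k.2; rewrite ?expr1 ?expr0; lra.
move=> k' kk' kl'; have := hx _ kl'; rewrite (negbTE kk') [height k' x]/height.
by case: k'.2; rewrite ?expr1 ?expr0; lra.
Qed.

Lemma null_strip_wall A l k t : k.1 != l.1 -> measurable A ->
  (forall x : 'rV[R]_d, A x -> height k x = t * height l x) -> nu A = 0%E.
Proof.
move=> kl mA At.
apply: (@null_box_wall _ _ nu nu_hyperplane A l k.1 ((-1) ^+ k.2 * t)) => // x Ax.
by rewrite -mulrA -At// /height mulrA -expr2 sqrr_sign mul1r.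
Qed.

Let m1 l := rmass nu (cell (fun=> 1) l).
Let n1 l := Num.truncn (N%:R * m1 l).

Let n1_itv l : (n1 l)%:R <= N%:R * m1 l < (n1 l)%:R + 1.
Proof.
have /truncn_itv : 0 <= N%:R * m1 l by rewrite mulr_ge0 ?rmass_ge0// ltW.
by rewrite natr1.
Qed.

Section feasible.
Variable l0 : face.

(** Rounding down in [n1] makes [b = 1] feasible. The lower bound 1/2 keeps the infimum positive and
    turns out never to be attained. *)
Definition feasible b := [/\ forall l, 1 / 2 <= b l <= 1, b l0 = 1 &
  forall l, l != l0 -> (n1 l)%:R <= N%:R * rmass nu (cell b l)].

Lemma feasible_gt0 b : feasible b -> forall k, 0 < b k.
Proof. by move=> [b1 _ _] k; have := b1 k; lra. Qed.

Lemma feasible1 : feasible (fun=> 1).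
Proof. by split=> // [l|l _]; [lra|case/andP: (n1_itv l)]. Qed.

(** At [l] the minimum equals, say, [b l]; passing from [b] to the minimum then lowers only other
    parameters, and [cell_sub] applies. *)
Lemma feasible_min b c : feasible b -> feasible c ->
  feasible (fun l => Num.min (b l) (c l)).
Proof.
move=> fb fc; have [b1 bl0 bm] := fb; have [c1 cl0 cm] := fc.
have bp := feasible_gt0 fb; have cp := feasible_gt0 fc.
split=> [l||l ll0].
- by have := b1 l; have := c1 l; rewrite /Num.min; case: ifP.
- by rewrite bl0 cl0 minxx.
have [bc|cb] := leP (b l) (c l).
  apply: le_trans (bm _ ll0) _; rewrite ler_pM2l//; apply: le_rmass => //.
  - exact: measurable_cell.
  - exact: measurable_cell.
  - apply: cell_sub => [k|]; last exact/min_idPl.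
    by rewrite le_min (ltW (bp _)) (ltW (cp _)) ge_min lexx.
apply: le_trans (cm _ ll0) _; rewrite ler_pM2l//; apply: le_rmass => //.
- exact: measurable_cell.
- exact: measurable_cell.
- apply: cell_sub => [k|]; last by apply/min_idPr; exact: ltW.
  by rewrite le_min (ltW (bp _)) (ltW (cp _)) ge_min lexx orbT.
Qed.

(* If [b l] is minimal, then [cell b l] lies in [cell 1 l]; it would miss a *)
(* strip of mass [1 / N] if it were much smaller than [b k].                *)
Lemma feasible_min_gap b l k : feasible b -> l != l0 -> k.1 != l.1 ->
  (forall j, b l <= b j) -> (1 - rho) * b k < b l.
Proof.
move=> fb ll0 kl bmin; rewrite ltNge; apply/negP => blk.
have [b1 bl0 bm] := fb; have bp := feasible_gt0 fb.
have r0 := rho_gt0; have r12 := rho12.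
pose S := strip l k (1 - rho) 1.
have mS : measurable S by exact: measurable_box.
have mC : measurable (cell b l) by exact: measurable_cell.
have : rmass nu (cell b l `|` S) <= m1 l.
  apply: le_rmass => //; [exact: measurableU|exact: measurable_cell|].
  move=> x [[sx h0 hx]|/(strip_height kl) [sx h0 /andP[hk1 hk2] hx]]; split=> // k'.
    rewrite !mul1r; have [h'0|/ltW h'0] := leP (height k' x) 0; first exact: le_trans h0.
    rewrite -(ler_pM2l (bp l)); apply: le_trans (hx k').
    by rewrite ler_wpM2r// ltW.
  rewrite !mul1r; have [kk'|kk'] := eqVneq k'.1 k.1.
    have [->|nkk'] := eqVneq k' k; first by lra.
    by rewrite (height_opp _ kk' nkk'); nra.
  have [lk'|lk'] := eqVneq k'.1 l.1.
    have [->//|nlk'] := eqVneq k' l.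
    by rewrite (height_opp _ lk' nlk'); lra.
  by have := hx _ kk' lk'; lra.
rewrite rmassU//; last first.
  apply: (@null_strip_wall _ l k (1 - rho)) => //; first exact: measurableI.
  move=> x [[_ h0 hx] /(strip_height kl)[_ _ /andP[hk1 _] _]].
  apply/le_anti; rewrite hk1 andbT -(ler_pM2l (bp k)).
  apply: le_trans (hx k) _.
  rewrite (_ : b k * _ = (1 - rho) * b k * height l x); last by ring.
  by rewrite ler_wpM2r.
have := @strip_mass 1 l k (1 - rho) 1 kl; rewrite !mul1r subrK => sm.
have {}sm : N%:R^-1 <= rmass nu S by apply: sm => //; lra.
(* The strip would push N times [m1 l] up to [n1 l + 1], against the rounding. *)
move=> h; have /andP[_] := n1_itv l; apply/negP; rewrite -leNgt.
apply: (@le_trans _ _ (N%:R * (rmass nu (cell b l) + rmass nu S))).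
  rewrite mulrDr lerD ?bm// -[leLHS](mulfV (lt0r_neq0 N0)).
  by rewrite ler_pM2l.
by rewrite ler_pM2l.
Qed.

(** Let [k] minimize [b]. If [k] is [l0] or lies on another axis, [b l0 = 1] and the gap lemma
    conclude. If [k] is opposite to [l0] and [b k <= 1/2], a lateral facet [j] has [b j <= 3/4], so
    [l0] gains a strip worth 2d+1 units, while the other facets lose at most 2d in total. *)
Lemma feasible_gt_half b l : feasible b -> 1 / 2 < b l.
Proof.
move=> fb; have [b1 bl0 bm] := fb; have bp := feasible_gt0 fb.
have r0 := rho_gt0; have r12 := rho12.
pose k := [arg min_(k < l) b k]%O.
have bmin j : b k <= b j by rewrite /k; case: arg_minP => // i _; exact.
apply: lt_le_trans (bmin l); have [->|kl0] := eqVneq k l0; first by rewrite bl0; lra.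
have [kl1|kl1] := eqVneq k.1 l0.1; last first.
  have kl1' : l0.1 != k.1 by rewrite eq_sym.
  by have := feasible_min_gap fb kl0 kl1' bmin; rewrite bl0; lra.
rewrite ltNge; apply/negP => bk.
have [i il0] : exists i : 'I_d, i != l0.1.
  have [e|ne] := eqVneq (Ordinal d_gt1) l0.1; last by exists (Ordinal d_gt1).
  by exists (Ordinal (ltnW d_gt1)); rewrite -e.
pose j : face := (i, false).
have jl0 : j.1 != l0.1 by [].
have bj : b j <= 3 / 4.
  have jk : j.1 != k.1 by rewrite kl1.
  have := feasible_min_gap fb kl0 jk bmin.
  by have := bp j; nra.
pose S := strip l0 j 1 (4 / 3).
have mS : measurable S by exact: measurable_box.
have mC : measurable (cell (fun=> 1) l0) by exact: measurable_cell.
have h1 : rmass nu (cell (fun=> 1) l0 `|` S) <= rmass nu (cell b l0).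
  apply: le_rmass => //; [exact: measurableU|exact: measurable_cell|].
  move=> x [|/(strip_height jl0) [sx h0 /andP[hk1 hk2] hx]].
    apply: cell_sub => // k'; rewrite (ltW (bp _)) /=.
    by case/andP: (b1 k').
  split=> // k'; rewrite bl0 mul1r; have /andP[_ bk'1] := b1 k'; have bk'0 := bp k'.
  have [jk'|jk'] := eqVneq k'.1 j.1.
    have [->|njk'] := eqVneq k' j; first by nra.
    by rewrite (height_opp _ jk' njk'); nra.
  have [lk'|lk'] := eqVneq k'.1 l0.1.
    have [->|nlk'] := eqVneq k' l0; first by rewrite bl0 mul1r.
    by rewrite (height_opp _ lk' nlk'); nra.
  by have := hx _ jk' lk'; nra.
have dd : (2 * d).+1%:R = 2 * d%:R + 1 :> R by rewrite -[LHS]natr1 natrM.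
(* As 9 d [rho] <= 1 and d >= 2, 2d+1 slabs of thickness [rho] fit between 1 and 4/3. *)
have sm : (2 * d).+1%:R / N%:R <= rmass nu S.
  apply: strip_mass => //; try lra.
  by rewrite dd; have := d_rho; have := d2; nra.
have h2 : N%:R * m1 l0 + (2 * d%:R + 1) <= N%:R * rmass nu (cell b l0).
  apply: (@le_trans _ _ (N%:R * (m1 l0 + rmass nu S))); last first.
    rewrite ler_pM2l//; apply: le_trans h1; rewrite rmassU//.
    apply: (@null_strip_wall _ l0 j 1) => //; first exact: measurableI.
    move=> x [[_ h0 hx] /(strip_height jl0)[_ _ /andP[hk1 _] _]].
    by apply/le_anti; rewrite hk1 andbT; have := hx j; rewrite !mul1r.
  rewrite mulrDr lerD2l [N%:R * _]mulrC -ler_pdivrMr//; apply: le_trans sm.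
  by rewrite dd.
have s1 : N%:R * m1 l0 + \sum_(l | l != l0) (N%:R * m1 l) = N%:R.
  rewrite -mulr_sumr -mulrDr -(@bigD1 _ _ _ _ l0 xpredT m1) //=.
  by rewrite sum_cell_mass ?mulr1.
have sb : N%:R * rmass nu (cell b l0) +
    \sum_(l | l != l0) (N%:R * rmass nu (cell b l)) = N%:R.
  rewrite -mulr_sumr -mulrDr.
  rewrite -(@bigD1 _ _ _ _ l0 xpredT (fun l => rmass nu (cell b l))) //=.
  by rewrite sum_cell_mass ?mulr1.
have : \sum_(l | l != l0) (N%:R * m1 l) <=
    \sum_(l | l != l0) (N%:R * rmass nu (cell b l)) + 2 * d%:R.
  apply: (@le_trans _ _ (\sum_(l | l != l0) (N%:R * rmass nu (cell b l) + 1))).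
    apply: ler_sum => l' ll'; have /andP[_ /ltW h] := n1_itv l'.
    by apply: le_trans h _; rewrite lerD2r bm.
  rewrite big_split /= lerD2l; apply: (@le_trans _ _ (\sum_(l : face) 1)).
    by rewrite [leRHS](bigD1 l0)//= lerDr.
  by rewrite sumr_const card_prod card_ord card_bool mulrC -natrM.
lra.
Qed.

Definition bstar l := inf [set b l | b in feasible].

Let has_inf_feasible l : has_inf [set b l | b in feasible].
Proof.
split; first by exists 1; exists (fun=> 1) => //; exact: feasible1.
by exists (1 / 2) => _ [b [b1 _ _] <-]; case/andP: (b1 l).
Qed.

Lemma bstar_le b l : feasible b -> bstar l <= b l.
Proof. by move=> fb; apply: ge_inf; [case: (has_inf_feasible l)|exists b]. Qed.

Lemma bstar_itv l : 1 / 2 <= bstar l <= 1.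
Proof.
rewrite (bstar_le l feasible1) andbT.
apply: lb_le_inf; first by case: (has_inf_feasible l).
by move=> _ [b [b1 _ _] <-]; case/andP: (b1 l).
Qed.

(** Closure under minima lets one feasible vector approach the infimum in all coordinates at
    once. *)
Lemma bstar_approx e : 0 < e ->
  exists2 c, feasible c & forall l, bstar l <= c l < bstar l + e.
Proof.
move=> e0.
have : forall s : seq face, exists2 c, feasible c &
    {in s, forall l, bstar l <= c l < bstar l + e}.
  elim=> [|l s [c fc cs]]; first by exists (fun=> 1) => //; exact: feasible1.
  have [_ [b fb <-] bl] := inf_adherent e0 (has_inf_feasible l).
  exists (fun k => Num.min (b k) (c k)); first exact: feasible_min.
  move=> k; rewrite inE le_min !bstar_le//= gt_min.
  by move=> /orP[/eqP->|/cs /andP[_ ->]]; rewrite ?bl ?orbT.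
move=> /(_ (enum {: face}))[c fc cs]; exists c => // l.
by apply: cs; rewrite mem_enum.
Qed.

(** Lowering every coordinate but [l] of a nearby feasible vector to [bstar] enlarges cell [l], so
    continuity in the single variable [b l] suffices. *)
Lemma feasible_bstar : feasible bstar.
Proof.
have bp k : 0 < bstar k by have := bstar_itv k; lra.
split=> [l||l ll0]; first exact: bstar_itv.
  apply/le_anti; rewrite (bstar_le l0 feasible1) /=.
  apply: lb_le_inf; first by case: (has_inf_feasible l0).
  by move=> _ [b [_ -> _] <-].
apply/ler_addgt0Pr => e e0.
have /cvgrPdist_lt /(_ (e / N%:R)) := @cell_mass_continuous bstar l _ bp (bp l).
rewrite divr_gt0// => /(_ isT)[del /= del0 hdel].
have [c fc ch] := bstar_approx del0.
have [_ _ /(_ l ll0) cm] := fc; apply: le_trans cm _.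
pose t := c l.
have {}hdel := hdel t; rewrite /= in hdel.
have /hdel : `|bstar l - t| < del.
  by rewrite ltr_norml; have := ch l; rewrite -/t; lra.
rewrite ltr_norml => /andP[+ _].
have -> : cell (updb bstar l (bstar l)) l = cell bstar l.
  by congr cell; apply/funext => k; rewrite /updb; case: eqP => // ->.
have : rmass nu (cell c l) <= rmass nu (cell (updb bstar l t) l).
  apply: le_rmass => //; [exact: measurable_cell|exact: measurable_cell|].
  apply: cell_sub => [k|]; last by rewrite /updb eqxx.
  rewrite /updb; case: eqVneq => [->|kl]; last by rewrite (ltW (bp k)) bstar_le.
  by rewrite lexx (ltW (feasible_gt0 fc l)).
move=> h1 h2; rewrite -[e](divfK (lt0r_neq0 N0)) [e / _ * _]mulrC -mulrDr ler_pM2l//.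
lra.
Qed.

(* Otherwise [bstar l] could be lowered within the feasible set. *)
Lemma bstar_mass l : l != l0 -> N%:R * rmass nu (cell bstar l) = (n1 l)%:R.
Proof.
move=> ll0; have [b1 bl0 bm] := feasible_bstar.
have bp := feasible_gt0 feasible_bstar.
apply/le_anti; rewrite bm// andbT leNgt; apply/negP => gap.
have bh := feasible_gt_half l feasible_bstar.
pose e := rmass nu (cell bstar l) - (n1 l)%:R / N%:R.
have e0 : 0 < e by rewrite subr_gt0 ltr_pdivrMr// mulrC.
have /cvgrPdist_lt /(_ e e0)[del /= del0 hdel] :=
  @cell_mass_continuous bstar l _ bp (bp l).
(* The maximum keeps [t] in the allowed range; [feasible_gt_half] keeps it below [bstar l]. *)
pose t := Num.max (1 / 2) (bstar l - del / 2).
have tb : t < bstar l by rewrite gt_max bh /=; lra.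
have t2 : bstar l - del / 2 <= t by rewrite le_max lexx orbT.
have t1 : 1 / 2 <= t by rewrite le_max lexx.
have bs1 := b1 l.
have /hdel /= : `|bstar l - t| < del by rewrite ltr_norml; lra.
have -> : cell (updb bstar l (bstar l)) l = cell bstar l.
  by congr cell; apply/funext => k; rewrite /updb; case: eqP => // ->.
rewrite ltr_norml => /andP[_ mt].
suff /(bstar_le l) : feasible (updb bstar l t) by rewrite /updb eqxx; lra.
split=> [k||k kl0].
- by rewrite /updb; case: eqP => // _; lra.
- by rewrite /updb eq_sym (negbTE ll0).
have [->|kl] := eqVneq k l.
  by rewrite mulrC -ler_pdivrMr//; move: mt; rewrite /e; lra.
apply: le_trans (bm _ kl0) _; rewrite ler_pM2l//.
apply: le_rmass => //; [exact: measurable_cell|exact: measurable_cell|].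
apply: cell_sub => [j|]; last by rewrite /updb (negbTE kl).
rewrite /updb; case: eqVneq => [->|_]; last by rewrite lexx ltW.
by rewrite (ltW tb); lra.
Qed.

End feasible.

(** All facets but [l0] have integral mass, and the total is N units, so [l0] is integral too. *)
Lemma exists_balanced_cells : exists b, (forall l, 1 / 2 <= b l <= 1) /\
  forall l, integral_mass nu N (cell b l).
Proof.
pose l0 : face := (Ordinal d_gt1, false).
exists (bstar l0); have [b1 _ _] := feasible_bstar l0; split=> // l.
have bp := feasible_gt0 (feasible_bstar l0).
have [->|ll0] := eqVneq l l0; last by exists (n1 l); exact: bstar_mass.
have : N%:R * rmass nu (cell (bstar l0) l0) + (\sum_(l | l != l0) n1 l)%:R = N%:R.
  rewrite natr_sum -(eq_bigr _ (@bstar_mass l0)) -mulr_sumr -mulrDr.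
  rewrite -(@bigD1 _ _ _ _ l0 xpredT (fun l => rmass nu (cell (bstar l0) l))) //=.
  by rewrite sum_cell_mass ?mulr1.
set n := (\sum_(l | _) _)%N => h; exists (N - n)%N.
have nN : (n <= N)%N.
  by rewrite -(ler_nat R) -h lerDr mulr_ge0 ?rmass_ge0// ltW.
by rewrite natrB// -[in RHS]h addrK.
Qed.

End balancing.

(** * Assembling the partition *)

Section partition.
Context {R : realType} {d : nat} (d_gt1 : (1 < d)%N) (w : 'rV[R]_d -> R).
Context (hw : is_weight w) (w1 : wmass w sphere = 1%:E)
  (w_gt0 : forall x (s : R), sphere x -> 0 < s -> (0 < wmass w (cap x s))%E).

Let nu : {measure set 'rV[R]_d -> \bar R} := weighted_measure hw.

Let wmassE (A : set 'rV[R]_d) : A `<=` sphere -> wmass w A = nu A.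
Proof. by move=> As; rewrite /nu /= /weighted_measure setIidl. Qed.

Let nuT : (nu setT < +oo)%E.
Proof. by rewrite /nu /= /weighted_measure setTI w1 ltry. Qed.

Lemma interior_disjoint (A B : set 'rV[R]_d) : measurable A -> measurable B ->
  A `<=` sphere -> nu (A `&` B) = 0%E ->
  interior (A : set (subspace sphere)) `&`
  interior (B : set (subspace sphere)) = set0.
Proof.
move=> mA mB As AB0; apply/seteqP; split => // x /(interior_cap As)[s sp [sx cAB]].
have /andP[s0 _] := sp; have := w_gt0 sx s0; rewrite wmassE; last by move=> y [].
rewrite (null_sub _ _ cAB AB0) ?ltxx//; last exact: measurableI.
by apply: measurable_cap => //; case/andP: sp => /ltW ->.
Qed.

Lemma trivial_partition (N : nat) (c r : R) : (0 < N)%N -> pi <= c * r ->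
  exists (M : nat) (P : 'I_M -> set 'rV[R]_d) (x : 'I_M -> 'rV[R]_d),
    convex_partition P /\
    forall j : 'I_M,
      [/\ sphere (x j), cap (x j) (1 * r) `<=` P j, P j `<=` cap (x j) (c * r) &
          exists k : nat, (0 < k)%N /\ (N%:R%:E * wmass w (P j))%E = k%:R%:E].
Proof.
move=> N0 cr; pose p : 'rV[R]_d := delta_mx ord0 (Ordinal d_gt1).
have sp : sphere p by apply/sphereP; rewrite dotv_delta mxE !eqxx.
exists 1%N, (fun=> sphere), (fun=> p); split.
  split=> [_||i j]; last by rewrite !ord1.
    split=> //.
      by apply/closed_subspaceP; exists setT; [exact: closedT|rewrite setTI setIid].
    by apply: cone_geodesically_convex => // x v t sx _; exact: great_circle_sphere.
  by apply/seteqP; split=> x; [exists ord0|case].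
move=> _; split=> //.
- by move=> x [].
- by move=> x sx; split=> //; apply: le_trans cr; case/andP: (geodist_itv sp sx).
- by exists N; rewrite w1 mule1.
Qed.

Lemma fine_partition (N : nat) (r : R) : (0 < N)%N -> 0 < r <= pi ->
  108 * d%:R ^+ 2 * r <= 1 ->
  (forall x, sphere x -> ((N%:R^-1)%:E <= wmass w (cap x r))%E) ->
  exists (M : nat) (P : 'I_M -> set 'rV[R]_d) (x : 'I_M -> 'rV[R]_d),
    convex_partition P /\
    forall j : 'I_M,
      [/\ sphere (x j), cap (x j) (1 * r) `<=` P j,
          P j `<=` cap (x j) (432 * d%:R ^+ 2 * r) &
          exists k : nat, (0 < k)%N /\ (N%:R%:E * wmass w (P j))%E = k%:R%:E].
Proof.
move=> N0 r_itv r_small hcap; have /andP[r0 rpi] := r_itv.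
have d2 : 2 <= d%:R :> R by rewrite ler_nat.
(* The least side for which a box contains a cap of radius r; the smallness of r says exactly 9 d
   [rho] <= 1. *)
pose rho := 12 * d%:R * r.
have rho0 : 0 < rho by rewrite !mulr_gt0//; lra.
have drho : 9 * d%:R * rho <= 1 by rewrite /rho; lra.
have rho1 : rho <= 1 by nra.
have nuH a : a != 0 -> nu [set x | dotv a x = 0] = 0%E.
  exact: weighted_measure_hyperplane.
have s1 : rmass nu sphere = 1 by rewrite /rmass -wmassE// w1.
have cap_mass x : sphere x -> N%:R^-1 <= rmass nu (cap x r).
  move=> sx; rewrite -lee_fin rmassK//; last first.
    by apply: measurable_cap; rewrite ?(ltW r0).
  by rewrite -wmassE ?hcap// => y [].
have [b [b1 bN]] := exists_balanced_cells nuT nuH N0 r_itv (lexx rho) rho0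
  d_gt1 drho s1 cap_mass.
have b0 k : 0 < b k by have := b1 k; lra.
have bq k k' : 1 / 2 <= b k / b k' <= 2.
  have := b1 k; have := b1 k' => /andP[h1 h2] /andP[h3 h4].
  by rewrite ler_pdivlMr// ler_pdivrMr//; lra.
(* Index type and bounds are packed together so that [choice] subdivides all facets at once. *)
pose sub l (s : {I : finType & I -> ('I_d -> R) * ('I_d -> R)}) :=
  let Q := projT2 s in
  [/\ forall i, [/\ box_bounded l (Q i).1 (Q i).2, wide rho l (Q i).1 (Q i).2,
        forall j, j != l.1 -> (Q i).2 j <= (Q i).1 j + 3 * rho &
        integral_mass nu N (box l (Q i).1 (Q i).2)],
      cell b l = \bigcup_i box l (Q i).1 (Q i).2 &
      forall i j, i != j ->
        nu (box l (Q i).1 (Q i).2 `&` box l (Q j).1 (Q j).2) = 0%E].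
have [f fP] : {f & forall l, sub l (f l)}.
  apply: choice => l; have imc := bN l; move: imc; rewrite cell_box//.
  set lo := (fun j => - _); set hi := (fun j => _ / _) => imc.
  have bd : box_bounded l lo hi.
    move=> j _; rewrite /lo /hi; have := bq l (j, true); have := bq l (j, false); lra.
  have wd : wide rho l lo hi.
    move=> j _; rewrite /lo /hi; have := bq l (j, true); have := bq l (j, false); lra.
  pose S := \sum_(j | j != l.1) (hi j - lo j).
  have S0 : 0 <= S / rho.
    by rewrite divr_ge0 ?(ltW rho0)// sumr_ge0// => j jl; have := wd _ jl; lra.
  have Sn : S <= (Num.truncn (S / rho)).+1%:R * rho.
    by rewrite -ler_pdivrMr// ltW//; case/andP: (truncn_itv S0).
  have [I [lo' [hi' [h1 h2 h3]]]] :=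
    exists_fine_cells nuT nuH N0 r_itv (lexx rho) rho0 rho1 cap_mass bd wd imc Sn.
  exists (existT (fun I : finType => I -> ('I_d -> R) * ('I_d -> R)) I
    (fun i => (lo' i, hi' i))).
  by split=> //; rewrite cell_box.
pose J : finType := {l : 'I_d * bool & projT1 (f l)}.
pose lo (s : J) := (projT2 (f (tag s)) (tagged s)).1.
pose hi (s : J) := (projT2 (f (tag s)) (tagged s)).2.
pose Q (s : J) := box (tag s) (lo s) (hi s).
have QP s : [/\ box_bounded (tag s) (lo s) (hi s), wide rho (tag s) (lo s) (hi s),
    forall j, j != (tag s).1 -> hi s j <= lo s j + 3 * rho & integral_mass nu N (Q s)].
  by case: s => l i; have [h _ _] := fP l; exact: h.
have Qcell s : Q s `<=` cell b (tag s).
  by case: s => l i; have [_ -> _] := fP l => x bx; exists i.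
have mQ s : measurable (Q s) by exact: measurable_box.
have Qs s : Q s `<=` sphere by exact: box_sub_sphere.
have Q0 s t : s != t -> nu (Q s `&` Q t) = 0%E.
  have [st|st] := eqVneq (tag s) (tag t); last first.
    move=> _; apply: null_sub (null_cellI nuH b0 st).
    - exact: measurableI.
    - by apply: measurableI; exact: measurable_cell.
    - by apply: setISS; exact: Qcell.
  case: s t st => l i [l' k] /= ll'; case: l' / ll' k => k ik.
  have [_ _ h] := fP l; apply: (h i k).
  by apply: contraNneq ik => ->.
exists #|J|, (fun j => Q (enum_val j)),
  (fun j => box_center (tag (enum_val j)) (lo (enum_val j)) (hi (enum_val j))).
split.
  split=> [j||i j ij].
  - split; [exact: Qs|exact: closed_box|].
    by have [bd _ _ _] := QP (enum_val j); exact: box_geodesically_convex.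
  - apply/seteqP; split=> [x|x [j _ /Qs]//].
    rewrite (bigcup_cell d_gt1 b0) => -[l _]; have [_ -> _] := fP l => -[i _ bx].
    pose s : J := Tagged (fun l => projT1 (f l)) i.
    by exists (enum_rank s) => //; rewrite enum_rankK.
  - apply: interior_disjoint => //; apply: Q0.
    by apply: contra_neq ij => /enum_val_inj.
move=> j; set s := enum_val j; have [bd wd w3 [k mk]] := QP s; rewrite mul1r.
have [sp _ _] := box_centerP (tag s) (lo s) (hi s).
split=> //.
- exact: (cap_sub_box bd wd r0 (lexx rho) rho1).
- have w3' i : i != (tag s).1 -> lo s i <= hi s i <= lo s i + 3 * rho.
    by move=> il; rewrite w3// andbT; have := wd _ il; lra.
  move=> x /(box_sub_cap bd w3' (ltW rho0)) [sx xr]; split=> //.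
  (* The radius obtained is 12 d [rho], that is 144 d^2 r. *)
  by apply: le_trans xr _; rewrite /rho; have := sqr_ge0 (d%:R : R); nra.
(* A wide cell has mass at least 1/N, so [k] is not 0. *)
exists k; split.
  have := le_box_mass nuT r_itv (lexx rho) rho1 cap_mass bd wd.
  rewrite lt0n => h; apply/eqP => k0; move: mk; rewrite k0 => /eqP.
  rewrite mulf_eq0 pnatr_eq0 -[N == 0%N]negbK -lt0n N0 /= gt_eqF//.
  by rewrite (lt_le_trans _ h)// invr_gt0 ltr0n.
by rewrite wmassE ?Qs// -(rmassK nuT)// -EFinM mk.
Qed.

End partition.

Theorem theorem1p4 (R : realType) (d : nat) (hd : (2 <= d)%N) :
  exists c c' : R, [/\ 0 < c, 0 < c' &
    forall (w : 'rV[R]_d -> R) (r : R) (N : nat),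
      is_weight w ->
      wmass w sphere = 1%:E ->
      (forall (x : 'rV[R]_d) (s : R), sphere x -> 0 < s ->
        (0 < wmass w (cap x s))%E) ->
      0 < r <= pi ->
      (0 < N)%N ->
      (forall x : 'rV[R]_d, sphere x ->
        ((N%:R^-1)%:E <= wmass w (cap x r))%E) ->
      exists (M : nat) (P : 'I_M -> set 'rV[R]_d) (x : 'I_M -> 'rV[R]_d),
        convex_partition P /\
        forall j : 'I_M,
          [/\ sphere (x j),
              cap (x j) (c' * r) `<=` P j,
              P j `<=` cap (x j) (c * r) &
              exists k : nat, (0 < k)%N /\
                (N%:R%:E * wmass w (P j))%E = k%:R%:E]].
Proof.
have d1 : 2 <= d%:R :> R by rewrite ler_nat.
(* 432 is 4 times 108: above the threshold 108 d^2 r = 1, the radius 432 d^2 r exceeds 4, hence pi,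
   and the whole sphere serves as the only cell. *)
exists (432 * d%:R ^+ 2), 1; split; last 1 first.
- move=> w r N hw w1 w0 r_itv N0 hcap.
  have [small|large] := leP (108 * d%:R ^+ 2 * r) 1.
    exact: (fine_partition hd hw w1 w0 N0 r_itv small hcap).
  apply: (trivial_partition hd w1 N0).
  have [/andP[_ pi4] _] := @pihalf_02_cos_pihalf R.
  by lra.
- by rewrite mulr_gt0 ?ltr0n// exprn_gt0//; lra.
- exact: ltr01.
Qed.
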